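(* Let $d$ be a (fixed) positive integer and let $\mathcal{J}$ be the set of all subsets of $\mathbb{Z}$ of the form $\{2^k-1,\dots,2^{k+1}-2\}$, $k\in\mathbb{N}_0$, or $\{-2^{l+1}+2,\dots,-2^l+1\}$, $l\in\mathbb{N}_0$. If $E\subset\mathbb{Z}^d$ is a non-empty set satisfying $$D_E=\sup_{I_1,\dots,I_d\in\mathcal{J}}\#\{E\cap(I_1\times\cdots\times I_d)\}<\infty,$$ then there exists a positive constant $A_{D_E}$, depending only on $D_E$ (for the fixed dimension $d$), such that for every $f\in L\log^{d/2}L(\mathbb{T}^d)$ $$\Big(\sum_{(k_1,\dots,k_d)\in E}|\widehat f(k_1,\dots,k_d)|^2\Big)^{1/2}\le A_{D_E}\Big[1+\int_{\mathbb{T}^d}|f|\log^{d/2}(1+|f|)\Big].$$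
   Context: $\mathbb{N}_0$ is the set of non-negative integers; $\#$ denotes cardinality. The torus $\mathbb{T}$ is identified with $[0,1)$, with Lebesgue measure, and $\widehat f(k)=\int_{\mathbb{T}^d}f(x)e^{-i2\pi k\cdot x}\,dx$. The notation $\log^{d/2}(1+|f|)$ means $(\log(1+|f|))^{d/2}$, and $L\log^{d/2}L(\mathbb{T}^d)$ is the space of measurable functions $f$ on $\mathbb{T}^d$ with $\int_{\mathbb{T}^d}|f|\log^{d/2}(1+|f|)<\infty$. *)

(* Defs.v *)
From HB Require Import structures.
From mathcomp Require Import all_boot all_order all_algebra.
From mathcomp Require Import all_classical all_reals all_analysis.
From mathcomp Require Import complex.

Set Implicit Arguments.
Unset Strict Implicit.
Unset Printing Implicit Defensive.

Import Order.TTheory GRing.Theory Num.Theory.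
Import numFieldNormedType.Exports.

Local Open Scope classical_set_scope.
Local Open Scope ring_scope.

Section lebesgue_vec.
Context {R : realType}.

Local Notation vec d := (d.-tuple (measurableTypeR R)).

Definition vec_cons d (p : measurableTypeR R * vec d) : vec d.+1 :=
  [tuple of p.1 :: p.2].

Lemma measurable_vec_cons d : measurable_fun [set: _] (@vec_cons d).
Proof. exact: measurable_cons. Qed.

Definition vec_uncons d (x : vec d.+1) : measurableTypeR R * vec d :=
  (tnth x ord0, [tuple of behead x]).

Lemma measurable_vec_uncons d : measurable_fun [set: _] (@vec_uncons d).
Proof.
apply: measurable_fun_pair; last exact: measurable_behead.
exact: measurable_tnth.
Qed.

Lemma vec_consK d : cancel (@vec_cons d) (@vec_uncons d).
Proof. by move=> [a x]; congr pair; apply/val_inj. Qed.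

Lemma vec_unconsK d : cancel (@vec_uncons d) (@vec_cons d).
Proof. by move=> x; rewrite /vec_cons/= -tuple_eta. Qed.

Section lebesgue_cons.
Local Open Scope ereal_scope.
Variables (d : nat) (mu : {sigma_finite_measure set (vec d) -> \bar R}).

Definition lebesgue_cons : set (vec d.+1) -> \bar R :=
  pushforward (@lebesgue_measure R \x mu) (@vec_cons d).

Let lebesgue_cons_pre A : measurable A -> measurable (@vec_cons d @^-1` A).
Proof. by move=> mA; rewrite -[X in measurable X]setTI; exact: measurable_vec_cons. Qed.

Let lebesgue_cons0 : lebesgue_cons set0 = 0.
Proof. by rewrite /lebesgue_cons /pushforward preimage_set0 measure0. Qed.

Let lebesgue_cons_ge0 A : 0 <= lebesgue_cons A.
Proof. by rewrite /lebesgue_cons /pushforward measure_ge0. Qed.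

Let lebesgue_cons_sigma_additive : semi_sigma_additive lebesgue_cons.
Proof.
move=> F mF tF mUF; rewrite /lebesgue_cons /pushforward preimage_bigcup.
apply: measure_semi_sigma_additive.
- by move=> n; exact: lebesgue_cons_pre.
- apply/trivIsetP => /= i j _ _ ij; rewrite -preimage_setI.
  by move/trivIsetP : tF => /(_ _ _ _ _ ij) ->//; rewrite preimage_set0.
- by rewrite -preimage_bigcup; exact: lebesgue_cons_pre.
Qed.

HB.instance Definition _ := isMeasure.Build _ _ _ lebesgue_cons
  lebesgue_cons0 lebesgue_cons_ge0 lebesgue_cons_sigma_additive.

Let lebesgue_cons_sigma_finite : sigma_finite setT lebesgue_cons.
Proof.
have /sigma_finiteP[F [TF ndF Foo]] := sigma_finiteT (@lebesgue_measure R).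
have /sigma_finiteP[G [TG ndG Goo]] := sigma_finiteT mu.
exists (fun n => @vec_uncons d @^-1` (F n `*` G n)) => [|n].
  rewrite -preimage_bigcup (_ : \bigcup_n _ = setT) ?preimage_setT//.
  rewrite -setXTT TF TG predeqE => -[x y]; split.
    by move=> [n _ []/= ? ?]; split; exists n.
  move=> [/= [n _ Fnx] [k _ Gky]]; exists (maxn n k) => //; split.
  - by move: x Fnx; exact/subsetPset/ndF/leq_maxl.
  - by move: y Gky; exact/subsetPset/ndG/leq_maxr.
have [mF Fy] := Foo n; have [mG Gy] := Goo n; split.
  rewrite -[X in measurable X]setTI.
  by apply: measurable_vec_uncons => //; exact: measurableX.
rewrite /lebesgue_cons /pushforward -comp_preimage.
rewrite (_ : _ \o _ = id) ?preimage_id; last first.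
  by apply/funext => x; exact: vec_consK.
by rewrite product_measure1E// lte_mul_pinfty// ge0_fin_numE.
Qed.

HB.instance Definition _ := Measure_isSigmaFinite.Build _ _ _
  lebesgue_cons lebesgue_cons_sigma_finite.

End lebesgue_cons.

(* Lebesgue measure on the Borel sets of R^d, as an iterated product along
   R^d.+1 = R * R^d; its value on boxes is [lebesgue_vec_box] below. *)
Fixpoint lebesgue_vec d : {sigma_finite_measure set (vec d) -> \bar R} :=
  match d with
  | 0 => \d_ ([tuple] : vec 0)
  | d'.+1 => lebesgue_cons (lebesgue_vec d')
  end.

Lemma lebesgue_vec_box d (A : 'I_d -> set (measurableTypeR R)) :
  (forall i, measurable (A i)) ->
  lebesgue_vec d [set x | forall i, A i (tnth x i)] =
  (\prod_(i < d) lebesgue_measure (A i))%E.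
Proof.
elim: d A => [|d IH] A mA /=.
  by rewrite big_ord0 diracE mem_set//; case.
rewrite /lebesgue_cons /pushforward.
pose B := [set x : vec d | forall i, A (lift ord0 i) (tnth x i)].
rewrite (_ : _ @^-1` _ = A ord0 `*` B); last first.
  apply/seteqP; split => -[a x] /=.
    move=> Aax; split; first exact: (Aax ord0).
    by move=> i; have := Aax (lift ord0 i); rewrite /vec_cons tnthS.
  move=> [Aa Bx] i; case: (unliftP ord0 i) => [j ->|->] //.
  by rewrite /vec_cons tnthS; exact: Bx.
rewrite product_measure1E//; last first.
  rewrite (_ : B = \bigcap_(i in [set: 'I_d])
      [set x : vec d | A (lift ord0 i) (tnth x i)]); last first.
    by apply/seteqP; split => x /= Bx i; [move=> _; exact: Bx|exact: (Bx i Logic.I)].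
  apply: fin_bigcap_measurable => // i _.
  by rewrite -[X in measurable X]setTI; exact: measurable_tnth.
by rewrite big_ord_recl /B (IH (fun i => A (lift ord0 i))).
Qed.

End lebesgue_vec.

Section torus.
Variables (R : realType) (d : nat).

(* [d.-tuple R] with the sigma-algebra of Lebesgue-measurable sets (the Borel
   sigma-algebra being the library's default on tuples). *)
Definition leb_space : measurableType _ :=
  caratheodory_type ((@lebesgue_vec R d)^*)%mu.

Definition leb : {measure set leb_space -> \bar R} :=
  @completed_measure_extension _ _ _ (@lebesgue_vec R d).

Definition torus : set leb_space :=
  [set x | forall i : 'I_d, tnth x i \in `[0, 1[].

Lemma torusE : torus =
  [set x : d.-tuple (measurableTypeR R) | forall i, `[0, 1[%classic (tnth x i)].
Proof. by []. Qed.

Let borel_torus : @measurable _ (d.-tuple (measurableTypeR R)) torus.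
Proof.
rewrite torusE (_ : [set x | _] = \bigcap_(i in [set: 'I_d])
    [set x : d.-tuple (measurableTypeR R) | `[0, 1[%classic (tnth x i)]).
  apply: fin_bigcap_measurable => // i _.
  rewrite -[X in measurable X]setTI; apply: (@measurable_tnth _ (measurableTypeR R) d i measurableT).
  exact: measurable_itv.
by apply/seteqP; split => x /= Tx i; [move=> _; exact: Tx|exact: (Tx i Logic.I)].
Qed.

Lemma measurable_torus : measurable torus.
Proof. by apply: sub_caratheodory; apply: sub_sigma_algebra. Qed.

Lemma leb_torus : leb torus = 1%E.
Proof.
rewrite /leb /= /completed_measure_extension measurable_mu_extE//.
apply: (etrans (@lebesgue_vec_box R d (fun=> `[0, 1[%classic) _)) => [i|].
  exact: measurable_itv.
by rewrite big1// => i _; rewrite lebesgue_measure_itv/= lte_fin ltr01 sube0.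
Qed.

Implicit Types f : leb_space -> R[i].

(* Integral of a complex function; meaningful for integrable [f] only, as
   [Rintegral] is 0 when the underlying extended real integral is infinite. *)
Definition torus_int f : R[i] :=
  Complex (\int[leb]_(x in torus) complex.Re (f x))
          (\int[leb]_(x in torus) complex.Im (f x)).

(* e^(it) *)
Definition expi (t : R) : R[i] := Complex (cos t) (sin t).

Definition dotz (k : d.-tuple int) (x : leb_space) : R :=
  \sum_(i < d) (tnth k i)%:~R * tnth x i.

Definition fourier f (k : d.-tuple int) : R[i] :=
  torus_int (fun x => f x * expi (- (2 * pi * dotz k x))).

(* The modulus as an element of R; [`|z|] lives in R[i]. *)
Definition cnorm (z : R[i]) : R := ComplexField.Normc.normc z.

Definition LlogL_int f : \bar R :=
  (\int[leb]_(x in torus)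
     (cnorm (f x) * (ln (1 + cnorm (f x))) `^ (d%:R / 2))%:E)%E.

Definition LlogL f : Prop :=
  [/\ measurable_fun torus (fun x => complex.Re (f x)),
      measurable_fun torus (fun x => complex.Im (f x)) &
      (LlogL_int f < +oo)%E].

End torus.

Definition dyadic_blocks : set (set int) :=
  [set I | (exists k : nat, I = [set m | 2 ^+ k - 1 <= m <= 2 ^+ k.+1 - 2])
        \/ (exists l : nat, I = [set m | - 2 ^+ l.+1 + 2 <= m <= - 2 ^+ l + 1])].

Definition D_ (R : realType) d (E : set (d.-tuple int)) : \bar R :=
  ereal_sup [set counting (E `&` [set k | forall i, I i (tnth k i)])
            | I in [set I : 'I_d -> set int | forall i, dyadic_blocks (I i)]].

(* Main.v *)
Require Import Defs.
From mathcomp Require Import all_boot all_order all_algebra.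
From mathcomp Require Import finmap.
From mathcomp Require Import all_classical all_reals all_analysis.
From mathcomp Require Import measurable_realfun complex ring lra zify.

(** By duality it is enough to understand trigonometric polynomials
    [h = sum_k kap_k cos (th_k + 2 pi k.x)] with frequencies in [E].  They are
    exponentially integrable: if [sum_k kap_k ^ 2 <= 1], then
    [int h ^ (2m) <= (C D m^d) ^ m] for all [m >= 1], with [C] depending on [d]
    only ([torus_moment]).  Splitting [|f||h|] according to the size of [|f|]
    turns these moment bounds into [int |f||h| <= A (1 + int |f| log^(d/2)(1+|f|))]
    ([LlogL_duality]), and taking for [kap] the normalised Fourier coefficients
    of [f] gives the theorem.

    The moment bound comes from martingales indexed by [d] independent dyadic
    scales.  On the grid of points of the torus with [M] binary digits in each
    coordinate, flipping a digit splits a function into a part invariant under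
    the flip and a part that changes sign.  For such a pair,
    [||a + b||_2m ^ 2 <= ||a||_2m ^ 2 + 4 m ||b||_2m ^ 2] ([moment_leD]).  Peeling
    off the digits of one coordinate, from the last to the first, bounds
    [||h||_2m ^ 2] by [4 m] times the sum over the scales [s] of
    [||D_s h||_2m ^ 2], where [D_s] is the martingale difference; doing this in
    all coordinates costs [(4 m) ^ d], which is where the exponent [d/2] of the
    logarithm comes from.  The pieces
    [D_(s_1) ... D_(s_d) h] are then bounded in sup norm: [D_s] multiplies the
    character of frequency [k] by an explicit product of one sine and some
    cosines, of size [O(2 ^ -|j - s|)] when [k] lies in the [j]-th dyadic block
    ([haar_coef_le]).

    The sum over the scales of the squared sup norms is then a quadratic form in
    the [|kap_k|] whose kernel decays geometrically in the distance between the
    dyadic blocks of the frequencies.  As every product of blocks contains at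
    most [D] frequencies, the Schur test bounds this form by
    [C D sum_k kap_k ^ 2] ([sum_block], [block_moment]).  A Riemann sum argument
    passes from the grid to the torus. *)

Set Implicit Arguments.
Unset Strict Implicit.
Unset Printing Implicit Defensive.

Import Order.TTheory GRing.Theory Num.Theory.
Import numFieldNormedType.Exports.

Local Open Scope classical_set_scope.
Local Open Scope ring_scope.

(** * Even moments of the sum of an even and an odd function *)

Section two_point.
Context {R : realDomainType}.
Implicit Types a b x y : R.

(** Multiplying by [(a + b) ^ 2] and [(a - b) ^ 2] acts linearly on the sum [s]
    and the difference [t] of the two powers, so both the signs and the bound of
    [t] by [s] propagate by induction; the bound is what controls the cross
    term in [two_point]. *)
Lemma two_point_even_odd (m : nat) (a b : R) :
  let s := (a + b) ^+ (2 * m) + (a - b) ^+ (2 * m) in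
  let t := (a + b) ^+ (2 * m) - (a - b) ^+ (2 * m) in
  [/\ 0 <= s, 0 <= a * b * t & a * b * t <= (2 * m)%:R * b ^+ 2 * s].
Proof.
elim: m => [|m [s_ge0 t_ge0 t_le]] /=.
  by rewrite muln0 !expr0 subrr !mulr0 mul0r; split=> //; lra.
have expE x : x ^+ (2 * m.+1) = x ^+ 2 * x ^+ (2 * m) by rewrite mulnS exprD.
rewrite !expE.
set p := (a + b) ^+ (2 * m) in s_ge0 t_ge0 t_le *.
set q := (a - b) ^+ (2 * m) in s_ge0 t_ge0 t_le *.
have sE : (a + b) ^+ 2 * p + (a - b) ^+ 2 * q =
    (a ^+ 2 + b ^+ 2) * (p + q) + 2 * (a * b * (p - q)) by ring.
have tE : a * b * ((a + b) ^+ 2 * p - (a - b) ^+ 2 * q) =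
    (a ^+ 2 + b ^+ 2) * (a * b * (p - q)) + 2 * (a * b) ^+ 2 * (p + q) by ring.
have ab_ge0 : 0 <= a ^+ 2 + b ^+ 2 by rewrite addr_ge0 ?sqr_ge0.
rewrite sE tE; split.
- by apply: addr_ge0; apply: mulr_ge0.
- by apply: addr_ge0; apply: mulr_ge0 => //; rewrite mulr_ge0 ?sqr_ge0.
- have := ler_wpM2l ab_ge0 t_le.
  have h1 : 0 <= (2 * m.+1)%:R * b ^+ 2 * (2 * (a * b * (p - q))).
    by apply: mulr_ge0; apply: mulr_ge0 => //; rewrite sqr_ge0.
  have h2 : 0 <= b ^+ 2 * b ^+ 2 * (p + q).
    by apply: mulr_ge0 => //; rewrite mulr_ge0 ?sqr_ge0.
  move: h1; rewrite mulnS natrD natrM.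
  move: (m%:R : R) (p + q) (a * b * (p - q)) h2 => n s t; nra.
Qed.

(** The two-point form of the 2-uniform smoothness of [L^2m].  Each increment
    of the exponent multiplies the left-hand side by at most
    [a ^ 2 + (4 n + 1) b ^ 2], with [n < m]. *)
Lemma two_point (m : nat) (a b : R) :
  (a + b) ^+ (2 * m) + (a - b) ^+ (2 * m)
    <= 2 * (a ^+ 2 + (4 * m)%:R * b ^+ 2) ^+ m.
Proof.
suff H n : (n <= m)%N -> (a + b) ^+ (2 * n) + (a - b) ^+ (2 * n)
    <= 2 * (a ^+ 2 + (4 * m)%:R * b ^+ 2) ^+ n by exact: H.
elim: n => [|n IH] nm; first by rewrite muln0 !expr0 mulr1.
have {}IH := IH (ltnW nm).
have [s_ge0 t_ge0 t_le] := two_point_even_odd n a b.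
have expE x : x ^+ (2 * n.+1) = x ^+ 2 * x ^+ (2 * n) by rewrite mulnS exprD.
rewrite !expE.
set p := (a + b) ^+ (2 * n) in IH s_ge0 t_ge0 t_le *.
set q := (a - b) ^+ (2 * n) in IH s_ge0 t_ge0 t_le *.
set c := a ^+ 2 + _ in IH *.
have c_ge0 : 0 <= c.
  by apply: addr_ge0; rewrite ?sqr_ge0//; apply: mulr_ge0; rewrite ?sqr_ge0 ?ler0n.
have sE : (a + b) ^+ 2 * p + (a - b) ^+ 2 * q =
    (a ^+ 2 + b ^+ 2) * (p + q) + 2 * (a * b * (p - q)) by ring.
rewrite sE [c ^+ n.+1]exprS [leRHS]mulrCA; apply: le_trans (ler_wpM2l c_ge0 IH).
have nm4 : 4 * n%:R + 1 <= (4 * m)%:R :> R.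
  suff : (4 * n + 1)%:R <= (4 * m)%:R :> R by rewrite natrD natrM.
  by rewrite ler_nat; lia.
have : (4 * n%:R + 1) * (b ^+ 2 * (p + q)) <= (4 * m)%:R * (b ^+ 2 * (p + q)).
  by apply: ler_wpM2r => //; apply: mulr_ge0 => //; rewrite sqr_ge0.
rewrite /c; move: t_le; rewrite natrM.
move: (p + q) (a * b * (p - q)) => s t; nra.
Qed.

Lemma expr_convex (m : nat) (x y l k : R) : 0 <= x -> 0 <= y -> 0 <= l ->
  0 <= k -> l + k = 1 ->
  (l * x + k * y) ^+ m <= l * x ^+ m + k * y ^+ m.
Proof.
move=> x0 y0 l0 k0 lk.
elim: m => [|m IH]; first by rewrite !expr0 !mulr1 lk.
have z0 : 0 <= l * x + k * y by rewrite addr_ge0 ?mulr_ge0.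
rewrite exprS; apply: le_trans (ler_wpM2l z0 IH) _.
have xy : 0 <= (x - y) * (x ^+ m - y ^+ m).
  have [yx|xy] := leP y x.
    by rewrite mulr_ge0// ?subr_ge0// lerXn2r.
  by rewrite mulr_le0// ?subr_le0 ?(ltW xy)// lerXn2r// ltW.
have := mulr_ge0 (mulr_ge0 l0 k0) xy.
have -> : k = 1 - l by rewrite -lk addrC addKr.
rewrite !exprS; clear; move: (x ^+ m) (y ^+ m) => u v; nra.
Qed.
End two_point.

Section moment.
Context {R : realFieldType} {T : finType}.
Implicit Types (f g : T -> R) (A B : R).

(** The normalised form [||f||_2m ^ 2 <= B] for the uniform probability on [T];
    bounding the square of the norm makes the bounds additive in
    [moment_leD]. *)
Definition moment_le (m : nat) (f : T -> R) (B : R) : Prop :=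
  \sum_t f t ^+ (2 * m) <= #|T|%:R * B ^+ m.

(** Minkowski in [L^m], from the convexity of [x ^ m] with weights [A / (A + B)]
    and [B / (A + B)]. *)
Lemma Minkowski_sum (m : nat) (u v : T -> R) (A B : R) : (0 < m)%N ->
  (forall t, 0 <= u t) -> (forall t, 0 <= v t) -> 0 <= A -> 0 <= B ->
  \sum_t u t ^+ m <= #|T|%:R * A ^+ m -> \sum_t v t ^+ m <= #|T|%:R * B ^+ m ->
  \sum_t (u t + v t) ^+ m <= #|T|%:R * (A + B) ^+ m.
Proof.
move=> m0 u0 v0.
have zero (w : T -> R) : (forall t, 0 <= w t) ->
    \sum_t w t ^+ m <= #|T|%:R * 0 ^+ m -> forall t, w t = 0.
  move=> w0; rewrite expr0n eqn0Ngt m0 mulr0 => le0 t; apply/eqP.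
  suff : w t ^+ m == 0 by rewrite expf_eq0 => /andP[].
  rewrite eq_le exprn_ge0// andbT (le_trans _ le0)// (bigD1 t)//= lerDl.
  by rewrite sumr_ge0// => i _; rewrite exprn_ge0.
rewrite le_eqVlt => /predU1P[<- _ /(zero _ u0) uE|A0].
  by rewrite add0r; under [X in _ -> X <= _]eq_bigr do rewrite uE add0r.
rewrite le_eqVlt => /predU1P[<- + /(zero _ v0) vE|B0].
  by rewrite addr0; under [X in _ -> X <= _]eq_bigr do rewrite vE addr0.
move=> uA vB; set S := A + B; have S0 : 0 < S by rewrite addr_gt0.
have step t : (u t + v t) ^+ m <=
    S ^+ m * (A / S / A ^+ m * u t ^+ m + B / S / B ^+ m * v t ^+ m).
  have -> : u t + v t = S * (A / S * (u t / A) + B / S * (v t / B)).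
    by field; rewrite !gt_eqF.
  rewrite exprMn ler_wpM2l ?exprn_ge0 ?(ltW S0)//.
  apply: le_trans (expr_convex _ _ _ _ _ _) _.
  - by rewrite divr_ge0// ltW.
  - by rewrite divr_ge0// ltW.
  - by rewrite divr_ge0// ltW.
  - by rewrite divr_ge0// ltW.
  - by rewrite -mulrDl divff// gt_eqF.
  - by rewrite !expr_div_n !mulrA !(mulrAC _ (_ ^-1) (_ ^+ m)).
apply: le_trans (ler_sum _ (fun t _ => step t)) _.
rewrite -mulr_sumr big_split/= -!mulr_sumr mulrC ler_wpM2r ?exprn_ge0 ?(ltW S0)//.
have cA : 0 <= A / S / A ^+ m by rewrite !divr_ge0 ?exprn_ge0// ltW.
have cB : 0 <= B / S / B ^+ m by rewrite !divr_ge0 ?exprn_ge0// ltW.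
apply: le_trans (lerD (ler_wpM2l cA uA) (ler_wpM2l cB vB)) _.
rewrite le_eqVlt; apply/orP; left; apply/eqP.
have := expf_neq0 m (lt0r_neq0 A0); have := expf_neq0 m (lt0r_neq0 B0).
rewrite /S => ? ?; field; apply/and3P; split=> //.
by rewrite gt_eqF.
Qed.

Lemma moment_leW (m : nat) (f : T -> R) A B : 0 <= A -> A <= B ->
  moment_le m f A -> moment_le m f B.
Proof.
move=> A0 AB fA; apply: le_trans fA _; rewrite ler_wpM2l// lerXn2r//.
exact: le_trans A0 AB.
Qed.

Lemma moment_le_norm (m : nat) (f : T -> R) C : (forall t, `|f t| <= C) ->
  moment_le m f (C ^+ 2).
Proof.
move=> fC; rewrite /moment_le -exprM mulr_natl -sumr_const; apply: ler_sum => t _.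
rewrite exprM -real_normK ?num_real// -exprM lerXn2r// nnegrE.
exact: le_trans (fC t).
Qed.

(** As [s] exchanges [a + b] and [a - b] and permutes [T], both have the same
    moments; their mean is bounded pointwise by [two_point], and Minkowski in
    [L^m] finishes. *)
Lemma moment_leD (m : nat) (s : T -> T) (a b : T -> R) A B : (0 < m)%N ->
  injective s -> (forall t, a (s t) = a t) -> (forall t, b (s t) = - b t) ->
  0 <= A -> 0 <= B -> moment_le m a A -> moment_le m b B ->
  moment_le m (fun t => a t + b t) (A + (4 * m)%:R * B).
Proof.
move=> m0 s_inj sa sb A0 B0 aA bB; rewrite /moment_le.
have sumE : \sum_t (a t + b t) ^+ (2 * m) = \sum_t (a t - b t) ^+ (2 * m).
  by rewrite (reindex_inj s_inj)/=; under eq_bigr do rewrite sa sb.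
have : \sum_t (a t + b t) ^+ (2 * m) <=
       \sum_t (a t ^+ 2 + (4 * m)%:R * b t ^+ 2) ^+ m.
  rewrite -(@ler_pM2l _ 2)// [leRHS]mulr_sumr mulr_natl mulr2n {2}sumE -big_split/=.
  by apply: ler_sum => t _; exact: two_point.
move=> /le_trans; apply; apply: Minkowski_sum => //.
- by move=> t; rewrite sqr_ge0.
- by move=> t; rewrite mulr_ge0 ?sqr_ge0.
- by rewrite mulr_ge0.
- by move: aA; rewrite /moment_le; under eq_bigr do rewrite exprM.
- under eq_bigr do rewrite exprMn -exprM.
  by rewrite -mulr_sumr exprMn mulrCA ler_wpM2l ?exprn_ge0.
Qed.

End moment.

(** * Trigonometric sums in the binary digits *)

Section trig_sum.
Context {R : realType} {T K : finType}.
Implicit Types (kap th : K -> R) (bet : K -> T -> R) (w : {ffun T -> bool}).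

Definition flip_bit (b : T) w : {ffun T -> bool} :=
  [ffun t => w t (+) (t == b)].

Lemma flip_bit_inj b : injective (flip_bit b).
Proof.
apply: (can_inj (g := flip_bit b)) => w; apply/ffunP => t.
by rewrite !ffunE -addbA addbb addbF.
Qed.

(** A point of the grid is given by its binary digits [w]; the phase of a
    character is an affine function of the digits. *)
Definition trig_sum kap th bet w : R :=
  \sum_k kap k * cos (th k + \sum_t (w t)%:R * bet k t).

(** Averaging or antisymmetrising in the digit [b] replaces the angle at [b] by
    a constant one ([0], respectively [pi]), the other angles being
    untouched: the class of trigonometric sums is stable. *)
Definition set_angle bet (b : T) (v : R) : K -> T -> R :=
  fun k t => if t == b then v else bet k t.

Definition even_part kap th bet b : {ffun T -> bool} -> R :=
  trig_sum (fun k => kap k * cos (bet k b / 2)) (fun k => th k + bet k b / 2)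
    (set_angle bet b 0).

Definition odd_part kap th bet b : {ffun T -> bool} -> R :=
  trig_sum (fun k => kap k * sin (bet k b / 2))
    (fun k => th k + bet k b / 2 - pi / 2) (set_angle bet b pi).

Lemma set_angle_sum bet b v k w :
  \sum_t (w t)%:R * set_angle bet b v k t =
  (w b)%:R * v + \sum_(t | t != b) (w t)%:R * bet k t.
Proof.
rewrite (bigD1 b)//= /set_angle eqxx; congr (_ + _).
by apply: eq_bigr => t /negPf ->.
Qed.

(** Half-angle formulas, with [x = bet k b]: the amplitudes become
    [kap cos (x / 2)] and [kap sin (x / 2)], the phase is moved to the midpoint,
    and the shift by [- pi / 2] turns the sine of the odd part into a cosine. *)
Lemma trig_sumE kap th bet b w :
  trig_sum kap th bet w = even_part kap th bet b w + odd_part kap th bet b w.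
Proof.
rewrite -big_split/=; apply: eq_bigr => k _.
rewrite !set_angle_sum (bigD1 b)//=.
set S := \sum_(t | _) _; set x := bet k b.
rewrite mulr0 add0r.
have -> : th k + x / 2 - pi / 2 + ((w b)%:R * pi + S) =
   (th k + S + x / 2 + (w b)%:R * pi) - pi / 2 by ring.
rewrite cosBpihalf.
have -> : th k + x / 2 + S = th k + S + x / 2 by ring.
case: (w b); rewrite ?mul0r ?mul1r ?add0r ?addr0.
  have -> : th k + (x + S) = th k + S + x / 2 + x / 2 by field.
  by rewrite sinDpi [LHS in _ * LHS]cosD; ring.
have -> : th k + S = th k + S + x / 2 - x / 2 by field.
rewrite [in LHS]cosB.
have -> : th k + S + x / 2 - x / 2 + x / 2 = th k + S + x / 2 by field.
ring.
Qed.

Lemma flip_bit_sum (b : T) (v : T -> R) w :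
  \sum_(t | t != b) (flip_bit b w t)%:R * v t =
  \sum_(t | t != b) (w t)%:R * v t.
Proof. by apply: eq_bigr => t /negPf tb; rewrite ffunE tb addbF. Qed.

Lemma even_part_flip kap th bet b w :
  even_part kap th bet b (flip_bit b w) = even_part kap th bet b w.
Proof.
by apply: eq_bigr => k _; rewrite !set_angle_sum flip_bit_sum !mulr0.
Qed.

Lemma odd_part_flip kap th bet b w :
  odd_part kap th bet b (flip_bit b w) = - odd_part kap th bet b w.
Proof.
rewrite /odd_part /trig_sum -sumrN; apply: eq_bigr => k _.
rewrite !set_angle_sum flip_bit_sum ffunE eqxx addbT.
set A := _ - _; set S := \sum_(t | _) _; rewrite -mulrN; congr (_ * _).
case: (w b); rewrite /= ?mul0r ?mul1r ?add0r.
  by rewrite [in RHS]addrCA [in RHS]addrC cosDpi opprK.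
by rewrite [in LHS]addrCA [in LHS]addrC cosDpi.
Qed.

Lemma trig_sum_norm kap th bet w : `|trig_sum kap th bet w| <= \sum_k `|kap k|.
Proof.
apply: le_trans (ler_norm_sum _ _ _) _; apply: ler_sum => k _.
by rewrite normrM ler_piMr// cos_max.
Qed.

(** For half-angles [x], finest digit first, the factor by which the amplitude is
    multiplied when the first [j] digits are averaged out and the next one, if
    any, is antisymmetrised; the value at [j = size x] is for the function with
    all digits averaged out. *)
Fixpoint haar_weight (x : seq R) (j : nat) : R :=
  if x is y :: x' then
    if j is j'.+1 then cos y * haar_weight x' j' else sin y
  else 1.

(** Peeling off the digits [bs] one after the other: the odd part for a digit is
    final, the even part is split further.  The bound [G] for the pieces may only
    depend on the amplitudes and on the angles outside [bs], which is what allows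
    the same argument to be repeated in the other coordinates. *)
Lemma trig_sum_moment (m : nat) (G : (K -> R) -> R) (bs : seq T) kap th bet :
  (0 < m)%N -> uniq bs -> (forall kap', 0 <= G kap') ->
  (forall kap' th' bet', (forall k, {in [predC bs], bet' k =1 bet k}) ->
     moment_le m (trig_sum kap' th' bet') (G kap')) ->
  moment_le m (trig_sum kap th bet) ((4 * m)%:R * \sum_(j < (size bs).+1)
    G (fun k => kap k * haar_weight [seq bet k b / 2 | b <- bs] j)).
Proof.
move=> m0; have m1 : 1 <= (4 * m)%:R :> R by rewrite ler1n muln_gt0.
elim: bs kap th bet => [|b bs IH] kap th bet /=.
  move=> _ G0 HG; rewrite big_ord1.
  apply: (@moment_leW _ _ _ _ (G kap)) => //; last exact: HG.
  by under eq_fun do rewrite mulr1; rewrite ler_peMl.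
move=> /andP[bbs ubs] G0 HG.
have even_le : moment_le m (even_part kap th bet b)
    ((4 * m)%:R * \sum_(j < (size bs).+1)
       G (fun k => kap k * haar_weight [seq bet k b / 2 | b <- b :: bs] j.+1)).
  rewrite (eq_bigr (fun j : 'I_(size bs).+1 => G (fun k => kap k * cos (bet k b / 2) *
      haar_weight [seq set_angle bet b 0 k c / 2 | c <- bs] j))); last first.
    move=> j _; congr (G _); apply/funext => k; rewrite /= mulrA.
    congr (_ * haar_weight _ _).
    apply/eq_in_map => c cbs; rewrite /set_angle ifN//.
    by apply: contraNneq bbs => <-.
  apply: IH => // kap' th' bet' H; apply: HG => k t.
  rewrite !inE negb_or => /andP[tb tbs]; rewrite H ?inE//.
  by rewrite /set_angle (negPf tb).
have odd_le : moment_le m (odd_part kap th bet b)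
    (G (fun k => kap k * sin (bet k b / 2))).
  apply: HG => k t; rewrite !inE negb_or => /andP[tb tbs].
  by rewrite /set_angle (negPf tb).
rewrite big_ord_recl/= mulrDr addrC.
have -> : trig_sum kap th bet =
    (fun w => even_part kap th bet b w + odd_part kap th bet b w).
  by apply/funext => w; exact: trig_sumE.
apply: (moment_leD m0 (@flip_bit_inj b)) => //.
- exact: even_part_flip.
- exact: odd_part_flip.
- by rewrite mulr_ge0// sumr_ge0.
Qed.

End trig_sum.

(** * Martingale differences of characters *)

Section grid_moment.
Context {R : realType}.

(** The digit of weight [2 ^ r] in a grid coordinate [n / 2 ^ M] contributes to
    the phase of the frequency [a] the angle [2 pi a 2 ^ r / 2 ^ M], of which only
    the half matters. *)
Definition haar_coef (M : nat) (a : int) (j : nat) : R :=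
  haar_weight [seq pi * a%:~R * 2 ^+ r / 2 ^+ M | r <- iota 0 M] j.

(** The Gram matrix over the scales: the sum over [s] of
    [(sum_k |kap_k| |coef_k(s)|) ^ 2], expanded into a double sum over
    frequencies, factors over the coordinates into such entries. *)
Definition haar_gram (M : nat) (a b : int) : R :=
  \sum_(j < M.+1) `|haar_coef M a j| * `|haar_coef M b j|.

(** Induction over the coordinates, each of which costs a factor [4 m]; when none
    is left, the sup norm [sum_k |kap_k|] bounds the moment. *)
Lemma grid_moment (d M m : nat) (K : finType) (fr : K -> 'I_d -> int)
    (cs : seq 'I_d) (kap th : K -> R) (bet : K -> 'I_d * 'I_M -> R) :
  (0 < m)%N -> uniq cs ->
  (forall k, {in cs, forall i r,
     bet k (i, r) = 2 * (pi * (fr k i)%:~R * 2 ^+ r / 2 ^+ M)}) ->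
  moment_le m (trig_sum kap th bet)
    ((4 * m)%:R ^+ size cs * \sum_k \sum_l `|kap k| * `|kap l| *
       \prod_(i <- cs) haar_gram M (fr k i) (fr l i)).
Proof.
move=> m0; elim: cs kap th bet => [|i cs IH] kap th bet /=.
  move=> _ _; rewrite expr0 mul1r.
  under eq_bigr do under eq_bigr do rewrite big_nil mulr1.
  under eq_bigr do rewrite -mulr_sumr.
  by rewrite -mulr_suml -expr2; apply: moment_le_norm => w; exact: trig_sum_norm.
move=> /andP[ics ucs] betE.
pose G (kap' : K -> R) : R := (4 * m)%:R ^+ size cs *
  \sum_k \sum_l `|kap' k| * `|kap' l| *
    \prod_(c <- cs) haar_gram M (fr k c) (fr l c).
(* [enum 'I_M] lists the digits of the coordinate [i], finest first. *)
pose bs : seq ('I_d * 'I_M) := [seq (i, r) | r <- enum 'I_M].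
have ubs : uniq bs by rewrite map_inj_uniq ?enum_uniq// => r r' [].
have G0 kap' : 0 <= G kap'.
  rewrite mulr_ge0 ?exprn_ge0// sumr_ge0// => k _; rewrite sumr_ge0// => l _.
  rewrite mulr_ge0 ?mulr_ge0// prodr_ge0// => c _.
  by rewrite sumr_ge0// => j _; rewrite mulr_ge0.
have := @trig_sum_moment R _ K m G bs kap th bet m0 ubs G0.
rewrite size_map size_enum_ord => H.
have -> : (4 * m)%:R ^+ (size cs).+1 * (\sum_k \sum_l `|kap k| * `|kap l| *
    \prod_(c <- i :: cs) haar_gram M (fr k c) (fr l c)) =
    (4 * m)%:R * \sum_(j < M.+1)
      G (fun k => kap k * haar_weight [seq bet k b / 2 | b <- bs] j).
  rewrite exprS -mulrA; congr (_ * _); rewrite /G -mulr_sumr; congr (_ * _).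
  rewrite [RHS]exchange_big; apply: eq_bigr => k _ /=.
  rewrite [RHS]exchange_big; apply: eq_bigr => l _ /=.
  rewrite big_cons mulrA {1}/haar_gram mulr_sumr mulr_suml.
  apply: eq_bigr => j _; congr (_ * _).
  have wE k' : haar_weight [seq bet k' b / 2 | b <- bs] j =
      haar_coef M (fr k' i) j.
    rewrite /haar_coef -val_enum_ord /bs -!map_comp; congr haar_weight.
    by apply: eq_map => r /=; rewrite betE ?mem_head// mulrC mulKf.
  by rewrite !wE !normrM; ring.
apply: H => kap' th' bet' Hb; apply: IH => // k c ccs r.
rewrite -betE ?in_cons ?ccs ?orbT//; apply: Hb; rewrite inE.
by apply/mapP => -[r' _ [cE _]]; rewrite -cE ccs in ics.
Qed.

End grid_moment.

Section haar_decay.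
Context {R : realType}.
Implicit Types x y : R.

Lemma MVT_sin x : 0 <= x -> exists2 c, 0 <= c <= x & sin x = cos c * x.
Proof.
move=> x0; have [|c] := @MVT_segment R sin cos 0 x x0.
  by apply: continuous_subspaceT => c; exact: continuous_sin.
by rewrite in_itv/= sin0 !subr0 => cx ->; exists c.
Qed.

Lemma norm_sin x : `|sin x| = `|sin `|x| |.
Proof. by case: (ger0P x) => // _; rewrite sinN normrN. Qed.

Lemma norm_sin_le x : `|sin x| <= `|x|.
Proof.
rewrite norm_sin; have [c _ ->] := MVT_sin (normr_ge0 x).
by rewrite normrM normr_id ler_piMl ?cos_max.
Qed.

(** The mean value theorem, with [cos c = 1 - 2 sin(c/2) ^ 2 >= 1/2] for
    [0 <= c <= 1]. *)
Lemma norm_sin_ge x : `|x| <= 1 -> `|x| / 2 <= `|sin x|.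
Proof.
move=> x1; rewrite norm_sin; have [c /andP[c0 cx] ->] := MVT_sin (normr_ge0 x).
rewrite normrM normr_id mulrC ler_wpM2r//; apply: le_trans (ler_norm _).
have -> : c = (c / 2) *+ 2 by rewrite mulr2n; field.
have := norm_sin_le (c / 2); rewrite (ger0_norm (divr_ge0 c0 _))// => sc.
rewrite cos_mulr2n cos2sin2 -[sin _ ^+ 2]real_normK ?num_real//.
have := normr_ge0 (sin (c / 2)); move: sc cx x1.
by move: `|sin _| `|x| => s y; nra.
Qed.

Lemma haar_weightE (x : seq R) j : (j <= size x)%N ->
  haar_weight x j = (\prod_(y <- take j x) cos y) *
    (if (j < size x)%N then sin (nth 0 x j) else 1).
Proof.
elim: x j => [|y x IH] [|j]//= jx; rewrite ?take0 ?big_nil ?mul1r//.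
by rewrite big_cons -mulrA IH.
Qed.

(** Vieta's telescoping of the doubling formula for the sine. *)
Lemma prod_cos_double y j :
  (\prod_(0 <= r < j) cos (y * 2 ^+ r)) * (2 ^+ j * sin y) = sin (y * 2 ^+ j).
Proof.
elim: j => [|j IH]; first by rewrite big_geq// !expr0 !mul1r mulr1.
have -> : y * 2 ^+ j.+1 = (y * 2 ^+ j) *+ 2 by rewrite exprS mulr2n; ring.
by rewrite sin_mulr2n -IH big_nat_recr//= exprS mulr2n; ring.
Qed.

Lemma haar_coef_eq (M : nat) (a : int) j : (j <= M)%N ->
  haar_coef M a j =
    (\prod_(0 <= r < j) cos (pi * a%:~R / 2 ^+ M * 2 ^+ r)) *
    (if (j < M)%N then sin (pi * a%:~R / 2 ^+ M * 2 ^+ j) else 1) :> R.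
Proof.
move=> jM; rewrite /haar_coef haar_weightE ?size_map ?size_iota//.
congr (_ * _).
  rewrite -map_take big_map take_iota (minn_idPl jM) /index_iota subn0.
  by apply: eq_bigr => r _; rewrite mulrAC.
by case: ifP => // jM'; rewrite (nth_map 0%N) ?size_iota// nth_iota// add0n mulrAC.
Qed.

Lemma pi_le4 : (pi : R) <= 4.
Proof. by have [/andP[_]] := @pihalf_02_cos_pihalf R; lra. Qed.

(** The blocks are [2 ^ j - 1 <= |a| <= 2 ^ (j+1) - 2], that is
    [2 ^ j <= |a| + 1 < 2 ^ (j+1)]. *)
Definition dyadic_rank (a : int) : nat := trunc_log 2 (`|a|%N.+1).

Definition gap (i j : nat) : nat := ((i - j) + (j - i))%N.

Lemma haar_coef_le1 (M : nat) (a : int) j : `|haar_coef M a j : R| <= 1.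
Proof.
rewrite /haar_coef; elim: [seq _ | _ <- _] j => [|y x IH] [|j]/=;
  rewrite ?normr1 ?sin_max// normrM.
by rewrite mulr_ile1 ?cos_max.
Qed.

Lemma dyadic_rankP (a : int) :
  (2 ^ dyadic_rank a <= `|a|%N.+1 < 2 ^ (dyadic_rank a).+1)%N.
Proof. exact: trunc_log_bounds. Qed.

(** Put [y = pi a / 2 ^ M] and [j = M - s].  When [s] is less than the rank of [a]
    the cosines telescope to [sin (2 ^ j y) / (2 ^ j sin y) = O(2 ^ s / |a|)];
    otherwise the sine alone is [O(|a| / 2 ^ s)].  The size assumption on [M] gives [|y| <= 1],
    so that [sin y] is comparable to [y]. *)
Lemma haar_coef_le (M : nat) (a : int) s : (s <= M)%N ->
  (4 * `|a| <= 2 ^ M)%N ->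
  `|haar_coef M a (M - s) : R| <= 8 * 2 ^- gap (dyadic_rank a) s.
Proof.
move=> sM aM.
have [a0|a_neq0] := eqVneq a 0.
  rewrite {}a0 /dyadic_rank /= trunc_log1 /gap sub0n add0n subn0.
  case: s sM => [|s] sM; first by apply: le_trans (haar_coef_le1 _ _ _) _; lra.
  rewrite haar_coef_eq ?leq_subr// mulr0 !mul0r sin0 ifT ?mulr0 ?normr0; last by lia.
  by rewrite mulr_ge0// invr_ge0 exprn_ge0.
have [rk1 rk2] := andP (dyadic_rankP a); set j := dyadic_rank a in rk1 rk2 *.
have n0 : (0 < `|a|)%N by rewrite absz_gt0.
set n := `|a|%N in aM rk1 rk2 n0.
have {}rk1 : 2 ^+ j <= 2 * n%:R :> R by rewrite -natrX -natrM ler_nat; lia.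
have {}rk2 : n%:R <= 2 * 2 ^+ j :> R by rewrite -exprS -natrX ler_nat; lia.
have {}aM : 4 * n%:R <= 2 ^+ M :> R by rewrite -natrX -natrM ler_nat.
have {}n0 : 1 <= n%:R :> R by rewrite ler1n.
have twoM : 0 < 2 ^+ M :> R by rewrite exprn_gt0.
have twos : 0 < 2 ^+ s :> R by rewrite exprn_gt0.
have twoj : 0 < 2 ^+ j :> R by rewrite exprn_gt0.
have pi4 := pi_le4; have pi2 := @pi_ge2 R.
have yE : `|pi * a%:~R / 2 ^+ M| = pi * n%:R / 2 ^+ M :> R.
  rewrite normf_div normrM (ger0_norm (pi_ge0 R)) (gtr0_norm twoM).
  by rewrite -intr_norm -abszE.
have twoMs : 2 ^+ (M - s) = 2 ^+ M / 2 ^+ s :> R.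
  by rewrite -[in RHS](subnK sM) exprD mulfK ?gt_eqF.
rewrite haar_coef_eq ?leq_subr//.
set y : R := pi * a%:~R / 2 ^+ M in yE *.
set P := \prod_(0 <= r < _) _; set S := if _ then _ else _.
have P1 : `|P| <= 1.
  rewrite normr_prod; apply: prodr_ile1 => r _.
  by rewrite normr_ge0 cos_max.
have S1 : `|S| <= 1 by rewrite /S; case: ifP => _; rewrite ?normr1 ?sin_max.
rewrite normrM; have [js|sj] := leqP j s.
  have -> : gap j s = (s - j)%N by clear -js; rewrite /gap; lia.
  have -> : 2 ^- (s - j) = 2 ^+ j / 2 ^+ s :> R.
    by rewrite -[in RHS](subnK js) exprD invfM mulrCA divff ?mulr1// gt_eqF.
  have [s0|s_gt0] := posnP s.
    have -> : j = 0%N by apply/eqP; rewrite -leqn0 -s0.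
    rewrite s0 expr0 divr1; apply: le_trans (_ : 1 <= _); last by lra.
    by rewrite mulr_ile1.
  rewrite /S ifT; last by clear -sM s_gt0; lia.
  apply: le_trans (_ : `|y * 2 ^+ (M - s)| <= _).
    by rewrite (le_trans _ (norm_sin_le _))// ler_piMl.
  rewrite normrM yE twoMs (gtr0_norm (divr_gt0 _ _))//.
  have -> : pi * n%:R / 2 ^+ M * (2 ^+ M / 2 ^+ s) = pi * n%:R / 2 ^+ s :> R.
    by field; rewrite !gt_eqF.
  rewrite mulrA ler_wpM2r ?invr_ge0 ?(ltW twos)//.
  by apply: le_trans (_ : 4 * n%:R <= _); [rewrite ler_wpM2r | lra].
have -> : gap j s = (j - s)%N by clear -sj; rewrite /gap; lia.
have -> : 2 ^- (j - s) = 2 ^+ s / 2 ^+ j :> R.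
  by rewrite -[in RHS](subnK (ltnW sj)) exprD invfM mulrCA divff ?mulr1// gt_eqF.
apply: le_trans (_ : `|P| <= _); first by rewrite ler_piMr.
have y1 : `|y| <= 1.
  rewrite yE ler_pdivrMr// mul1r (le_trans _ aM)// ler_wpM2r//.
have siny := norm_sin_ge y1.
have : `|P| * (2 ^+ (M - s) * `|sin y|) <= 1.
  have := prod_cos_double y (M - s); rewrite -/P => /(congr1 Num.norm).
  rewrite !normrM (gtr0_norm (exprn_gt0 _ _))// => ->.
  exact: sin_max.
have : n%:R / 2 ^+ s <= 2 ^+ (M - s) * `|sin y|.
  apply: le_trans (ler_wpM2l (exprn_ge0 _ _) siny) => //.
  rewrite yE twoMs.
  have -> : 2 ^+ M / 2 ^+ s * (pi * n%:R / 2 ^+ M / 2) = pi / 2 * (n%:R / 2 ^+ s) :> R.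
    by field; rewrite !gt_eqF.
  rewrite ler_peMl ?divr_ge0 ?(ltW twos)//; lra.
move=> /(ler_wpM2l (normr_ge0 P)) /le_trans h /h {h}.
rewrite mulrA ler_pdivrMr// mul1r mulrA ler_pdivlMr// => Pn.
apply: le_trans (_ : `|P| * (2 * n%:R) <= _); first by rewrite ler_wpM2l.
by rewrite mulrCA; lra.
Qed.

(** A rate with [rho ^ 2 >= 1/2]: one factor [rho] of the decay [2 ^ -gap] goes to
    the distance between the blocks, the other makes the sum over the scales
    converge. *)
Definition rho : R := 3 / 4.

Lemma rho_gt0 : 0 < rho. Proof. by rewrite /rho; lra. Qed.

Lemma half_le_rho2 n : 2 ^- n <= rho ^+ n * rho ^+ n.
Proof.
rewrite -exprMn -exprVn lerXn2r// ?nnegrE ?mulr_ge0 /rho//; lra.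
Qed.

Lemma sum_rho n : \sum_(s < n) rho ^+ s = 4 * (1 - rho ^+ n).
Proof.
elim: n => [|n IH]; first by rewrite big_ord0 expr0 subrr mulr0.
by rewrite big_ord_recr/= IH exprS; move: (rho ^+ n) => u; rewrite /rho; lra.
Qed.

(** Moving the centre from [j] to [j + 1] adds at most [rho ^ (j+1)]; the
    strengthened bound [8 - 4 rho ^ j] absorbs it because [5 rho <= 4]. *)
Lemma sum_rho_gap j n : \sum_(s < n) rho ^+ gap j s <= 8.
Proof.
have r1 k : 0 <= rho ^+ k by rewrite exprn_ge0 ?(ltW rho_gt0).
suff : \sum_(s < n) rho ^+ gap j s <= 8 - 4 * rho ^+ j.
  by have := r1 j; lra.
elim: j n => [|j IH] n.
  rewrite expr0 (eq_bigr (fun s : 'I_n => rho ^+ s)) => [|s _]; last first.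
    by rewrite /gap sub0n subn0.
  by rewrite sum_rho; have := r1 n; lra.
have := r1 j => rj; rewrite exprS.
case: n => [|n].
  have rj1 : rho ^+ j <= 1 by rewrite exprn_ile1 ?(ltW rho_gt0)// /rho; lra.
  rewrite big_ord0; move: (rho ^+ j) rj rj1 => u; rewrite /rho; lra.
rewrite big_ord_recl (_ : gap _ _ = j.+1); last by rewrite /gap /=; lia.
rewrite (eq_bigr (fun s : 'I_n => rho ^+ gap j s)) => [|s _]; last first.
  by rewrite /gap.
have := IH n; rewrite exprS; move: (rho ^+ j) rj (\sum_(i < n) _) => u.
by rewrite /rho => ? ?; lra.
Qed.

(** By the triangle inequality, [gap a s + gap b s] is at least both [gap a b]
    and [gap a s]. *)
Lemma haar_gram_le (M : nat) (a b : int) :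
  (4 * `|a| <= 2 ^ M)%N -> (4 * `|b| <= 2 ^ M)%N ->
  haar_gram M a b <= 512 * rho ^+ gap (dyadic_rank a) (dyadic_rank b).
Proof.
move=> aM bM; set ja := dyadic_rank a; set jb := dyadic_rank b.
have r1 k : 0 <= rho ^+ k by rewrite exprn_ge0 ?(ltW rho_gt0).
rewrite /haar_gram (reindex_inj rev_ord_inj)/=.
apply: le_trans (_ : \sum_(s < M.+1) 64 * (rho ^+ gap ja jb * rho ^+ gap ja s) <= _).
  apply: ler_sum => s _; rewrite subSS.
  have sM : (s <= M)%N by rewrite -ltnS.
  have := ler_pM (normr_ge0 _) (normr_ge0 _) (haar_coef_le sM aM) (haar_coef_le sM bM).
  move=> /le_trans; apply; rewrite -/ja -/jb.
  have : (2 ^- gap ja s) * (2 ^- gap jb s) <= rho ^+ gap ja jb * rho ^+ gap ja s.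
    rewrite -invfM -(exprD 2); apply: le_trans (half_le_rho2 _) _.
    apply: ler_pM => //; apply: ler_wiXn2l; rewrite ?(ltW rho_gt0)//.
    - by rewrite /rho; lra.
    - by rewrite /gap; lia.
    - by rewrite /rho; lra.
    - by rewrite /gap; lia.
  by rewrite mulrACA (_ : 8 * 8 = 64); [move=> ?; rewrite ler_wpM2l | ring].
rewrite -!mulr_sumr; have := sum_rho_gap ja M.+1 => /(ler_wpM2l (r1 (gap ja jb))).
move=> /(ler_wpM2l (ler0n R 64)) /le_trans; apply.
by rewrite le_eqVlt; apply/orP; left; apply/eqP; ring.
Qed.

End haar_decay.

(** * The Schur test and the counting of frequencies *)

Section schur.
Context {R : realFieldType} {K : finType}.

Lemma Schur_test (V : K -> K -> R) (C : R) (kap : K -> R) :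
  (forall k l, 0 <= V k l) -> (forall k l, V k l = V l k) ->
  (forall k, \sum_l V k l <= C) ->
  \sum_k \sum_l `|kap k| * `|kap l| * V k l <= C * \sum_k kap k ^+ 2.
Proof.
move=> V0 Vsym VC.
have half : \sum_k \sum_l kap k ^+ 2 * V k l <= C * \sum_k kap k ^+ 2.
  rewrite mulr_sumr; apply: ler_sum => k _; rewrite -mulr_sumr mulrC.
  by rewrite ler_wpM2r ?sqr_ge0.
have swap : \sum_k \sum_l kap l ^+ 2 * V k l = \sum_k \sum_l kap k ^+ 2 * V k l.
  rewrite exchange_big; apply: eq_bigr => k _; apply: eq_bigr => l _.
  by rewrite Vsym.
rewrite -(ler_pM2l (ltr0n R 2)).
apply: le_trans (_ : \sum_k \sum_l kap k ^+ 2 * V k l +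
    \sum_k \sum_l kap l ^+ 2 * V k l <= _); last by rewrite swap; lra.
rewrite -big_split mulr_sumr; apply: ler_sum => k _.
rewrite -big_split mulr_sumr; apply: ler_sum => l _ /=.
rewrite -mulrDl mulrA ler_wpM2r// -(real_normK (num_real (kap k))).
rewrite -(real_normK (num_real (kap l))).
have := sqr_ge0 (`|kap k| - `|kap l|); move: `|kap k| `|kap l| => x y; nra.
Qed.

End schur.

Section block_count.
Context {R : realType}.

Lemma gapC i j : gap i j = gap j i.
Proof. by rewrite /gap addnC. Qed.

(** The members of [dyadic_blocks], indexed by rank and sign; both signs give
    [{0}] at rank [0]. *)
Definition dyadic_block (c : nat * bool) : set int :=
  if c.2 then [set a | - 2 ^+ c.1.+1 + 2 <= a <= - 2 ^+ c.1 + 1]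
  else [set a | 2 ^+ c.1 - 1 <= a <= 2 ^+ c.1.+1 - 2].

Lemma dyadic_blocks_block c : dyadic_blocks (dyadic_block c).
Proof. by case: c => j [|]; [right|left]; exists j. Qed.

Lemma dyadic_block_rank (a : int) : dyadic_block (dyadic_rank a, a < 0) a.
Proof.
rewrite /dyadic_block /=; have := dyadic_rankP a.
move: (dyadic_rank a) => j; rewrite -!(ltr_nat int) -!(ler_nat int) !natrX.
by case: (ltP a 0) => a0 /=; move: (2 ^+ j) (2 ^+ j.+1) => u v; lia.
Qed.

Lemma card_block (d : nat) (K : finType) (fr : K -> d.-tuple int)
    (E : set (d.-tuple int)) (D : R) (c : 'I_d -> nat * bool) (A : {pred K}) :
  (D_ R E <= D%:E)%E -> injective fr -> (forall k, E (fr k)) ->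
  (forall k, k \in A -> forall i, dyadic_block (c i) (tnth (fr k) i)) ->
  #|A|%:R <= D.
Proof.
move=> ED fr_inj frE Ac; rewrite -lee_fin; apply: le_trans ED.
pose I i := dyadic_block (c i).
set B := E `&` [set k | forall i, I i (tnth k i)].
have BD : (counting B <= D_ R E)%E.
  by apply: ereal_sup_ubound; exists I => // i; exact: dyadic_blocks_block.
apply: le_trans BD; rewrite /counting; case: asboolP => [finB|]; last by rewrite leey.
rewrite lee_fin ler_nat cardE -(size_map fr); apply: uniq_leq_size.
  by rewrite map_inj_uniq ?enum_uniq.
move=> x /mapP[k]; rewrite mem_enum => kA ->.
by rewrite in_fset_set// inE; split; [exact: frE | exact: Ac].
Qed.

(** Grouping the frequencies [l] by rank and sign in each coordinate: a group has
    at most [D] elements, and the sum over the groups factors into [d] sums, each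
    at most [2 * 512 * 8 = 8192], where [2] counts the signs. *)
Lemma sum_block (d : nat) (K : finType) (fr : K -> d.-tuple int)
    (E : set (d.-tuple int)) (D : R) (k : K) :
  (D_ R E <= D%:E)%E -> injective fr -> (forall k, E (fr k)) ->
  \sum_l \prod_(i < d) (512 * (rho : R) ^+ gap (dyadic_rank (tnth (fr k) i))
      (dyadic_rank (tnth (fr l) i))) <= D * 8192 ^+ d.
Proof.
move=> ED fr_inj frE.
pose rk l i := dyadic_rank (tnth (fr l) i).
have r1 n : 0 <= (rho : R) ^+ n by rewrite exprn_ge0 ?(ltW (rho_gt0)).
have D0 : 0 <= D.
  have := @card_block d K fr E D (fun=> (0%N, false)) pred0 ED fr_inj frE.
  by rewrite card0; apply.
pose N := \max_(li : K * 'I_d) rk li.1 li.2.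
pose p l : {ffun 'I_d -> 'I_N.+1 * bool} :=
  [ffun i => (inord (rk l i), tnth (fr l) i < 0)].
have pE l i : ((p l i).1 : nat, (p l i).2) = (rk l i, tnth (fr l) i < 0).
  rewrite ffunE /= inordK// ltnS.
  exact: (@leq_bigmax _ (fun li : K * 'I_d => rk li.1 li.2) (l, i)).
rewrite (partition_big p predT)//=.
pose F i (c : 'I_N.+1 * bool) : R := 512 * (rho : R) ^+ gap (rk k i) c.1.
have F0 i c : 0 <= F i c by apply: mulr_ge0; [exact: ler0n | exact: r1].
apply: le_trans (_ : \sum_(c : {ffun 'I_d -> 'I_N.+1 * bool})
    D * \prod_i F i (c i) <= _).
  apply: ler_sum => c _.
  have FE l : p l == c -> \prod_(i < d) (512 * (rho : R) ^+
      gap (dyadic_rank (tnth (fr k) i)) (dyadic_rank (tnth (fr l) i))) =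
      \prod_i F i (c i).
    by move=> /eqP <-; apply: eq_bigr => i _; rewrite /F; have [-> _] := pE l i.
  rewrite (eq_bigr _ FE).
  rewrite sumr_const -mulr_natl ler_wpM2r//.
    by apply: prodr_ge0 => i _; exact: F0.
  apply: (card_block (A := [pred l | p l == c]) (c := fun i => ((c i).1 : nat, (c i).2)) ED fr_inj frE).
  move=> l; rewrite inE => /eqP <- i; rewrite pE; exact: dyadic_block_rank.
rewrite -mulr_sumr ler_wpM2l// -bigA_distr_bigA.
rewrite -[X in _ ^+ X]card_ord -prodr_const; apply: ler_prod => i _.
apply/andP; split; first by apply: sumr_ge0 => c _; exact: F0.
rewrite -(pair_bigA _ (fun j b => F i (j, b)))/= exchange_big/= /F/=.
rewrite big_const card_bool iter_addr addr0 -mulr_sumr.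
by have := @sum_rho_gap R (rk k i) N.+1; lra.
Qed.

Definition grid_angle (d M : nat) (K : finType) (fr : K -> d.-tuple int)
    (k : K) (t : 'I_d * 'I_M) : R :=
  2 * (pi * (tnth (fr k) t.1)%:~R * 2 ^+ t.2 / 2 ^+ M).

Lemma block_moment (d M m : nat) (K : finType) (fr : K -> d.-tuple int)
    (E : set (d.-tuple int)) (D : R) (kap th : K -> R) :
  (0 < m)%N -> (D_ R E <= D%:E)%E -> injective fr -> (forall k, E (fr k)) ->
  (forall k i, (4 * `|tnth (fr k) i| <= 2 ^ M)%N) ->
  moment_le m (trig_sum kap th (grid_angle (M := M) fr))
    ((4 * m)%:R ^+ d * (D * 8192 ^+ d * \sum_k kap k ^+ 2)).
Proof.
move=> m0 ED fr_inj frE frM.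
have r1 n : 0 <= (rho : R) ^+ n by rewrite exprn_ge0 ?(ltW (rho_gt0)).
have gram0 a b : 0 <= haar_gram M a b :> R.
  by apply: sumr_ge0 => j _; rewrite mulr_ge0.
have := @grid_moment R d M m K (fun k => tnth (fr k)) (enum 'I_d) kap th
  (grid_angle (M := M) fr) m0 (enum_uniq _) (fun k i _ r => erefl).
rewrite size_enum_ord; apply: moment_leW.
  rewrite mulr_ge0 ?exprn_ge0// sumr_ge0// => k _; rewrite sumr_ge0// => l _.
  by rewrite !mulr_ge0// prodr_ge0.
rewrite ler_wpM2l ?exprn_ge0//.
apply: le_trans (Schur_test (V := fun k l => \prod_(i < d) (512 * (rho : R) ^+
  gap (dyadic_rank (tnth (fr k) i)) (dyadic_rank (tnth (fr l) i)))) _ _ _ _).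
- apply: ler_sum => k _; apply: ler_sum => l _; rewrite ler_wpM2l ?mulr_ge0//.
  rewrite big_enum; apply: ler_prod => i _.
  by rewrite gram0 haar_gram_le.
- move=> k l; apply: prodr_ge0 => i _.
  by apply: mulr_ge0; [exact: ler0n | exact: r1].
- by move=> k l; apply: eq_bigr => i _; rewrite gapC.
- by move=> k; exact: sum_block ED fr_inj frE.
Qed.

End block_count.

(** * From the dyadic grid to the torus *)

Section real_estimates.
Context {R : realType}.
Implicit Types x y : R.

Lemma norm_cosB_le x y : `|cos x - cos y| <= `|x - y|.
Proof.
pose u := (x + y) / 2; pose v := (x - y) / 2.
have [xE yE] : x = u + v /\ y = u - v by rewrite /u /v; split; field.
move: u v xE yE => u v -> ->; rewrite cosD cosB.
have -> : u + v - (u - v) = 2 * v by ring.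
have -> : cos u * cos v - sin u * sin v - (cos u * cos v + sin u * sin v) =
  2 * (- sin u * sin v) by ring.
rewrite !normrM normrN ler_wpM2l//; apply: le_trans (norm_sin_le v).
by rewrite ler_piMl// sin_max.
Qed.

Lemma norm_exprB_le n x y (H : R) : `|x| <= H -> `|y| <= H ->
  `|x ^+ n - y ^+ n| <= n%:R * H ^+ n.-1 * `|x - y|.
Proof.
move=> xH yH; have H0 : 0 <= H by exact: le_trans xH.
rewrite subrXX normrM mulrC ler_wpM2r//.
apply: le_trans (ler_norm_sum _ _ _) _.
rewrite mulr_natl -[X in _ *+ X]card_ord -sumr_const; apply: ler_sum => i _.
rewrite normrM !normrX.
have -> : H ^+ n.-1 = H ^+ (n.-1 - i) * H ^+ i.
  by rewrite -exprD subnK// -ltnS prednK// (leq_ltn_trans _ (ltn_ord i)).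
rewrite -subn1 -subnDA add1n ler_pM ?exprn_ge0//; exact: lerXn2r.
Qed.

Lemma binary_digits M x : 0 <= x < 2 ^+ M ->
  exists b : nat -> bool, 0 <= x - \sum_(r < M) (b r)%:R * 2 ^+ r < 1.
Proof.
elim: M x => [|M IH] x.
  by rewrite expr0 => x01; exists (fun=> false); rewrite big_ord0 subr0.
move=> /andP[x0 xM]; pose t := 2 ^+ M <= x.
have [|b bP] := IH (x - t%:R * 2 ^+ M).
  move: xM; rewrite /t exprS; case: (leP (2 ^+ M) x) => /=; lra.
exists (fun r => if (r < M)%N then b r else t).
rewrite big_ord_recr/= ltnn.
rewrite (eq_bigr (fun r : 'I_M => (b r)%:R * 2 ^+ r)).
  by rewrite opprD addrCA addrA [X in X + _]addrC addrAC.
by move=> r _; rewrite ltn_ord.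
Qed.

End real_estimates.

Section torus_moment.
Context {R : realType} {d : nat}.

Lemma leb_measurable (A : set (d.-tuple (measurableTypeR R))) :
  measurable A -> measurable (A : set (leb_space R d)).
Proof. by move=> mA; apply: sub_caratheodory; apply: sub_sigma_algebra. Qed.

Lemma measurable_coord (i : 'I_d) :
  measurable_fun setT (fun x : leb_space R d => tnth x i).
Proof.
move=> _ B mB; apply: leb_measurable.
exact: (@measurable_tnth _ (measurableTypeR R) d i measurableT).
Qed.

Definition cube (a : 'I_d -> R) (l : R) : set (leb_space R d) :=
  [set x | forall i, a i <= tnth x i < a i + l].

Lemma cubeE (a : 'I_d -> R) (l : R) : cube a l =
  [set x : d.-tuple (measurableTypeR R) | forall i,
     `[a i, (a i + l)[%classic (tnth x i)].
Proof.
by apply/seteqP; split => x xA i; have := xA i; rewrite /= in_itv.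
Qed.

Lemma measurable_borel_cube (a : 'I_d -> R) (l : R) :
  @measurable _ (d.-tuple (measurableTypeR R)) (cube a l).
Proof.
rewrite cubeE (_ : [set x | _] = \bigcap_(i in [set: 'I_d])
    [set x : d.-tuple (measurableTypeR R) | `[a i, (a i + l)[%classic (tnth x i)]).
  apply: fin_bigcap_measurable => // i _.
  rewrite -[X in measurable X]setTI.
  apply: (@measurable_tnth _ (measurableTypeR R) d i measurableT).
  exact: measurable_itv.
by apply/seteqP; split => x /= Tx i; [move=> _; exact: Tx|exact: (Tx i Logic.I)].
Qed.

Lemma measurable_cube (a : 'I_d -> R) (l : R) : measurable (cube a l).
Proof. by apply: leb_measurable; exact: measurable_borel_cube. Qed.

Lemma leb_cube (a : 'I_d -> R) (l : R) : 0 <= l ->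
  leb R d (cube a l) = (l ^+ d)%:E.
Proof.
move=> l0; rewrite /leb /= /completed_measure_extension measurable_mu_extE//; last first.
  exact: measurable_borel_cube.
rewrite cubeE; apply: (etrans (@lebesgue_vec_box R d
  (fun i => `[a i, (a i + l)[%classic) _)) => [i|].
  exact: measurable_itv.
rewrite (eq_bigr (fun=> l%:E)); last first.
  move=> i _; rewrite lebesgue_measure_itv/= lte_fin ltrDl.
  case: ltP => [_|l0']; first by rewrite -EFinB addrC addKr.
  by congr EFin; apply: le_anti; rewrite l0.
by rewrite prodEFin prodr_const card_ord.
Qed.

Definition trig_poly (K : finType) (fr : K -> d.-tuple int) (kap th : K -> R)
    (x : leb_space R d) : R :=
  \sum_k kap k * cos (th k + 2 * pi * dotz (fr k) x).

Lemma measurable_dotz (k : d.-tuple int) :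
  measurable_fun setT (dotz k : leb_space R d -> R).
Proof.
apply: measurable_sum => i; apply: measurable_funM; first exact: measurable_cst.
exact: measurable_coord.
Qed.

Lemma measurable_trig_poly (K : finType) (fr : K -> d.-tuple int)
    (kap th : K -> R) : measurable_fun setT (trig_poly fr kap th).
Proof.
apply: measurable_sum => k; apply: measurable_funM; first exact: measurable_cst.
apply: measurableT_comp.
  by apply: continuous_measurable_fun; exact: continuous_cos.
apply: measurable_funD; first exact: measurable_cst.
apply: measurable_funM; first exact: measurable_cst.
exact: measurable_dotz.
Qed.



Definition grid_point M (w : {ffun 'I_d * 'I_M -> bool}) : d.-tuple R :=
  [tuple \sum_(r < M) (w (i, r))%:R * 2 ^+ r / 2 ^+ M | i < d].

Lemma trig_poly_grid (K : finType) (fr : K -> d.-tuple int) (kap th : K -> R)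
    M (w : {ffun 'I_d * 'I_M -> bool}) :
  trig_poly fr kap th (grid_point w) = trig_sum kap th
    (grid_angle (M := M) fr) w.
Proof.
apply: eq_bigr => k _; congr (_ * cos (_ + _)).
transitivity (\sum_(i < d) \sum_(r < M) (w (i, r))%:R *
  (2 * (pi * (tnth (fr k) i)%:~R * 2 ^+ r / 2 ^+ M)) : R); last first.
  by rewrite pair_bigA; apply: eq_bigr => -[i r] _.
rewrite /dotz mulr_sumr.
apply: eq_bigr => i _; rewrite tnth_mktuple !mulr_sumr.
by apply: eq_bigr => r _; ring.
Qed.

(** The covering that turns a bound at the grid points into a bound of the
    integral. *)
Lemma torus_sub_cubes M (x : leb_space R d) : torus x ->
  exists w : {ffun 'I_d * 'I_M -> bool},
    cube (tnth (grid_point w)) (2 ^- M) x.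
Proof.
move=> xT.
have twoM : 0 < 2 ^+ M :> R by rewrite exprn_gt0.
have digits i : exists b : nat -> bool,
    0 <= tnth x i * 2 ^+ M - \sum_(r < M) (b r)%:R * 2 ^+ r < 1.
  apply: binary_digits; have := xT i; rewrite /= in_itv/= => /andP[x0 x1].
  by rewrite mulr_ge0 ?(ltW twoM)//= gtr_pMl.
have /choice[b bP] := digits.
exists [ffun t : 'I_d * 'I_M => b t.1 t.2] => i; rewrite tnth_mktuple.
under eq_bigr do rewrite ffunE /=.
rewrite -mulr_suml -[X in _ + X]mul1r -mulrDl ler_pdivrMr// ltr_pdivlMr//.
by have /andP[] := bP i; lra.
Qed.

Lemma trig_poly_le (K : finType) (fr : K -> d.-tuple int) (kap th : K -> R) x :
  `|trig_poly fr kap th x| <= \sum_k `|kap k|.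
Proof.
apply: le_trans (ler_norm_sum _ _ _) _; apply: ler_sum => k _.
by rewrite normrM ler_piMr// cos_max.
Qed.

Lemma trig_poly_lipschitz (K : finType) (fr : K -> d.-tuple int)
    (kap th : K -> R) : exists2 L : R, 0 <= L & forall (a : d.-tuple R) l x,
  cube (tnth a) l x ->
  `|trig_poly fr kap th x - trig_poly fr kap th a| <= L * l.
Proof.
exists (\sum_k `|kap k| * (2 * pi * \sum_(i < d) `|(tnth (fr k) i)%:~R|)).
  apply: sumr_ge0 => k _; rewrite mulr_ge0// mulr_ge0 ?mulr_ge0 ?pi_ge0//.
  exact: sumr_ge0.
move=> a l x xa; rewrite -sumrB mulr_suml.
apply: le_trans (ler_norm_sum _ _ _) _; apply: ler_sum => k _.
rewrite -mulrBr normrM -[leRHS]mulrA ler_wpM2l//.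
apply: le_trans (norm_cosB_le _ _) _.
rewrite opprD addrACA subrr add0r -mulrBr normrM.
rewrite ger0_norm ?mulr_ge0 ?pi_ge0// -[leRHS]mulrA ler_wpM2l ?mulr_ge0 ?pi_ge0//.
rewrite -sumrB mulr_suml; apply: le_trans (ler_norm_sum _ _ _) _.
apply: ler_sum => i _; rewrite -mulrBr normrM ler_wpM2l//.
by have /andP[? ?] := xa i; rewrite ler_norml; apply/andP; split; lra.
Qed.

(** A Riemann sum: on each cube [h ^ (2m)] exceeds its value at the corner by
    [O(2 ^ - M)], and the mean over the corners is bounded by [block_moment]
    uniformly in [M]. *)
Lemma torus_moment (m : nat) (K : finType) (fr : K -> d.-tuple int)
    (E : set (d.-tuple int)) (D : R) (kap th : K -> R) :
  (0 < m)%N -> (D_ R E <= D%:E)%E -> injective fr -> (forall k, E (fr k)) ->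
  (\int[leb R d]_(x in @torus R d) (trig_poly fr kap th x ^+ (2 * m))%:E <=
    (((4 * m)%:R ^+ d * (D * 8192 ^+ d * \sum_k kap k ^+ 2)) ^+ m)%:E)%E.
Proof.
move=> m0 ED fr_inj frE; set B := _ * _; set h := trig_poly fr kap th.
apply/lee_addgt0Pr => e e0.
have [L L0 hL] := trig_poly_lipschitz fr kap th.
pose H := \sum_k `|kap k|.
have H0 : 0 <= H by exact: sumr_ge0.
pose C := (2 * m)%:R * H ^+ (2 * m).-1 * L.
have C0 : 0 <= C by rewrite !mulr_ge0 ?exprn_ge0.
pose N := \max_k \max_(i < d) `|tnth (fr k) i|%N.
(* [M] makes the oscillation on the cubes at most [e], and the grid fine enough
   for all frequencies. *)
have [M MC MN] : exists2 M, C / 2 ^+ M <= e & (4 * N <= 2 ^ M)%N.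
  have [n nC] : exists n : nat, C / e < n%:R.
    by exists (Num.bound (C / e)); rewrite archi_boundP// divr_ge0// ltW.
  exists (n + 4 * N)%N; last first.
    by rewrite (leq_trans (ltnW (ltn_expl (4 * N) (isT : 1 < 2)%N)))// leq_exp2l// leq_addl.
  rewrite ler_pdivrMr ?exprn_gt0// mulrC -ler_pdivrMr// (le_trans (ltW nC))//.
  rewrite -natrX ler_nat (leq_trans (ltnW (ltn_expl n (isT : 1 < 2)%N)))//.
  by rewrite leq_exp2l// leq_addr.
have frM k i : (4 * `|tnth (fr k) i| <= 2 ^ M)%N.
  apply: leq_trans MN; rewrite leq_mul2l/=.
  apply: leq_trans (_ : \max_(i < d) `|tnth (fr k) i|%N <= _)%N.
    exact: (@leq_bigmax _ (fun i => `|tnth (fr k) i|%N)).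
  exact: (@leq_bigmax _ (fun k => \max_(i < d) `|tnth (fr k) i|%N)).
pose Om := {ffun 'I_d * 'I_M -> bool}.
have twoM : 0 < 2 ^- M :> R by rewrite invr_gt0 exprn_gt0.
pose c (w : Om) := h (grid_point w) ^+ (2 * m) + e.
have c0 w : 0 <= c w by rewrite addr_ge0 ?(ltW e0)// exprM exprn_ge0// sqr_ge0.
have hc x : torus x -> h x ^+ (2 * m) <=
    \sum_(w : Om) c w * \1_(cube (tnth (grid_point w)) (2 ^- M)) x.
  move=> /(torus_sub_cubes M)[w xw]; rewrite (bigD1 w)//= indicE mem_set// mulr1.
  apply: le_trans (_ : c w <= _); last first.
    by rewrite lerDl sumr_ge0// => v _; rewrite mulr_ge0.
  rewrite -lerBlDl (le_trans (ler_norm _))//.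
  apply: le_trans (norm_exprB_le _ (trig_poly_le _ _ _ _) (trig_poly_le _ _ _ _)) _.
  rewrite -/H; apply: le_trans MC; rewrite /C -[leRHS]mulrA ler_wpM2l//.
    by rewrite mulr_ge0 ?exprn_ge0.
  exact: hL xw.
have mC (w : Om) := measurable_cube (tnth (grid_point w)) (2 ^- M).
have mT : measurable (@torus R d) by exact: measurable_torus.
have mI (w : Om) : measurable_fun (@torus R d) (fun x =>
    (c w * \1_(cube (tnth (grid_point w)) (2 ^- M)) x)%:E).
  apply/measurable_EFinP; apply: measurable_funM; first exact: measurable_cst.
  exact: measurable_indic.
apply: le_trans (_ : \int[leb R d]_(x in @torus R d) \sum_(w : Om)
    (c w * \1_(cube (tnth (grid_point w)) (2 ^- M)) x)%:E <= _)%E.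
  apply: (ge0_le_integral _ mT).
  - by move=> x _; rewrite lee_fin exprM exprn_ge0// sqr_ge0.
  - apply/measurable_EFinP; apply: measurable_funX.
    by apply: measurable_funS (measurable_trig_poly _ _ _).
  - by apply: emeasurable_sum.
  - by move=> x xT; rewrite sumEFin lee_fin hc.
rewrite ge0_integral_sum//; last first.
  by move=> w x _; rewrite lee_fin mulr_ge0.
apply: le_trans (_ : \sum_(w : Om) (c w * (2 ^- M) ^+ d)%:E <= _)%E.
  apply: lee_sum => w _; under eq_integral do rewrite EFinM.
  have mI1 : measurable_fun (@torus R d) (fun x =>
      (\1_(cube (tnth (grid_point w)) (2 ^- M)) x : R)%:E).
    by apply/measurable_EFinP; exact: measurable_indic.
  rewrite (ge0_integralZl _ mT mI1); [|by move=> x _; rewrite lee_fin|exact: c0].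
  rewrite EFinM lee_wpmul2l ?lee_fin// integral_indic//.
  rewrite -(leb_cube (tnth (grid_point w)) (ltW twoM)).
  by apply: le_measure; rewrite ?inE//; exact: measurableI.
rewrite sumEFin -EFinD lee_fin -mulr_suml big_split/= sumr_const.
have cardOm : #|Om|%:R * (2 ^- M) ^+ d = 1 :> R.
  rewrite card_ffun card_bool card_prod !card_ord natrX -exprVn -exprM mulnC.
  by rewrite -exprMn divff// expr1n.
rewrite mulrDl -[e *+ _]mulr_natl mulrAC cardOm mul1r lerD2r.
have -> : B ^+ m = #|Om|%:R * B ^+ m * (2 ^- M) ^+ d.
  by rewrite mulrAC cardOm mul1r.
rewrite ler_wpM2r ?exprn_ge0 ?(ltW twoM)//.
under eq_bigr => w _ do rewrite /h trig_poly_grid.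
exact: (block_moment _ _ m0 ED fr_inj frE frM).
Qed.

End torus_moment.

(** * From moments to the space L log^(d/2) L *)

Section LlogL_duality.
Context {R : realType}.

(** If [b > t] then [b <= b (b / t) ^ (2n-1)]. *)
Lemma split_product (a b t E : R) (n : nat) : (0 < n)%N -> 0 <= a -> 0 <= b ->
  0 < t -> a <= E -> a * b <= a * t + E / t ^+ (2 * n).-1 * b ^+ (2 * n).
Proof.
move=> n0 a0 b0 t0 aE.
have E0 : 0 <= E by exact: le_trans aE.
have c0 : 0 <= E / t ^+ (2 * n).-1 by rewrite divr_ge0 ?exprn_ge0// ltW.
have [bt|tb] := leP b t.
  apply: le_trans (ler_wpM2l a0 bt) _; rewrite lerDl.
  by apply: mulr_ge0 => //; exact: exprn_ge0.
apply: le_trans (_ : E / t ^+ (2 * n).-1 * b ^+ (2 * n) <= _); last first.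
  by rewrite lerDr mulr_ge0// ltW.
apply: le_trans (ler_wpM2r b0 aE) _.
rewrite -mulrA ler_wpM2l//.
have -> : b ^+ (2 * n) = b ^+ (2 * n).-1 * b.
  by rewrite -exprSr prednK// muln_gt0.
rewrite mulrA ler_peMl// mulrC ler_pdivlMr ?exprn_gt0// mul1r.
by rewrite lerXn2r ?nnegrE// ltW.
Qed.

Variable d : nat.

Definition half_pow (n : nat) : R := n%:R `^ (d%:R / 2).

Lemma half_pow_sqr n : half_pow n ^+ 2 = n%:R ^+ d.
Proof.
rewrite /half_pow -powR_mulrn ?powR_ge0// -powRrM mulfVK// powR_mulrn//.
Qed.

Lemma half_pow_ge1 n : (0 < n)%N -> 1 <= half_pow n.
Proof.
move=> n0; rewrite -[leLHS](powRr0 n%:R).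
by apply: ler_powR; rewrite ?ler1n// divr_ge0.
Qed.

Lemma half_pow_le n : (0 < n)%N -> half_pow n <= (2 ^+ d) ^+ n.
Proof.
move=> n0; apply: le_trans (_ : half_pow n ^+ 2 <= _).
  by rewrite ler_eXnr// half_pow_ge1.
rewrite half_pow_sqr exprAC lerXn2r ?nnegrE ?exprn_ge0//.
by rewrite -natrX ler_nat ltnW// ltn_expl.
Qed.

(** Half the exponent of the moment that is used where [|f| = a]. *)
Definition log_level (a : R) : nat := (Num.trunc (ln (1 + a))).+1.

Lemma le_exp_log_level a : 0 <= a -> a <= expR 1 ^+ log_level a.
Proof.
move=> a0; have a1 : 0 < 1 + a by rewrite ltr_pwDl.
apply: le_trans (_ : 1 + a <= _); first by rewrite lerDr.
rewrite -[1 + a]lnK// -expRM_natl ler_expR mulr1 ltW//.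
exact: truncnS_gt.
Qed.

Lemma half_pow_log_level a : 0 <= a ->
  a * half_pow (log_level a) <=
    expR 1 + 2 `^ (d%:R / 2) * (a * ln (1 + a) `^ (d%:R / 2)).
Proof.
move=> a0; have a1 : 0 < 1 + a by rewrite ltr_pwDl.
have l0 : 0 <= ln (1 + a) by rewrite ln_ge0// lerDl.
have c0 : 0 <= 2 `^ (d%:R / 2) :> R by exact: powR_ge0.
have d0 : 0 <= d%:R / 2 :> R by rewrite divr_ge0.
have [l1|l1] := ltP (ln (1 + a)) 1.
  have nE : log_level a = 1%N.
    by congr S; apply/eqP; rewrite -leqn0 truncn_le_nat.
  rewrite /half_pow nE powR1 mulr1; apply: le_trans (le_exp_log_level a0) _.
  rewrite nE expr1 lerDl mulr_ge0// mulr_ge0// powR_ge0//.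
apply: le_trans (_ : 2 `^ (d%:R / 2) * (a * ln (1 + a) `^ (d%:R / 2)) <= _).
  rewrite mulrCA ler_wpM2l// -powRM//.
  rewrite /half_pow; apply: ge0_ler_powR => //; rewrite ?nnegrE ?mulr_ge0//.
  have := @truncn_itv _ _ l0 => /andP[+ _].
  by rewrite /log_level -natr1; lra.
by rewrite lerDr expR_ge0.
Qed.

(** The square root is the factor [B] of the threshold [B n^(d/2)] for [|h|] on
    the set where [|f|] is at most [e ^ n].  The factors under the root balance,
    in this order, the size of [f], the constant of the moment bound, and the
    growth of [n^(d/2)] together with the summation over [n]. *)
Definition dual_const (Q : R) : R :=
  Num.sqrt (expR 1 * Q * 2 ^+ d.+1) * (expR 1 + 2 `^ (d%:R / 2) + 1).

(** Where [a] has level [n], either [|h| <= B n^(d/2)], which produces the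
    logarithm, or [|h|] is large and [h ^ (2n)] takes over.  The choice of [B]
    makes the contribution of the second case at most [B / 2 ^ n]. *)
Lemma LlogL_duality (a h : leb_space R d -> R) (Q : R) : 0 < Q ->
  (forall x, 0 <= a x) ->
  measurable_fun (@torus R d) a -> measurable_fun (@torus R d) h ->
  (forall n, (0 < n)%N ->
    (\int[leb R d]_(x in @torus R d) (h x ^+ (2 * n))%:E <=
      ((n%:R ^+ d * Q) ^+ n)%:E)%E) ->
  (\int[leb R d]_(x in @torus R d) (a x * `|h x|)%:E <=
    (dual_const Q)%:E * (1 + \int[leb R d]_(x in @torus R d)
       (a x * ln (1 + a x) `^ (d%:R / 2))%:E))%E.
Proof.
move=> Q0 a0 ma mh hQ.
have mT : measurable (@torus R d) by exact: measurable_torus.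
set B := Num.sqrt (expR 1 * Q * 2 ^+ d.+1).
have B0 : 0 < B by rewrite sqrtr_gt0 !mulr_gt0 ?expR_gt0 ?exprn_gt0.
have B2 : B ^+ 2 = expR 1 * Q * 2 ^+ d.+1.
  by rewrite sqr_sqrtr// !mulr_ge0 ?expR_ge0 ?exprn_ge0// ltW.
pose L x : R := a x * ln (1 + a x) `^ (d%:R / 2).
have L0 x : 0 <= L x by rewrite mulr_ge0 ?powR_ge0.
have mL : measurable_fun (@torus R d) L.
  apply: measurable_funM; first exact: ma.
  apply: (measurableT_comp (measurable_powR (d%:R / 2)) (g := fun x => ln (1 + a x))).
  apply: (measurableT_comp (@measurable_ln R) (g := fun x => 1 + a x)).
  by apply: measurable_funD; [exact: measurable_cst|exact: ma].
pose w k : R := expR 1 ^+ k.+1 / (B * half_pow k.+1) ^+ (2 * k.+1).-1.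
have half_pow0 k : 0 < half_pow k.+1 by rewrite (lt_le_trans ltr01)// half_pow_ge1.
have w0 k : 0 <= w k.
  apply: divr_ge0; apply: exprn_ge0; first exact: expR_ge0.
  by apply: mulr_ge0; exact: ltW.
pose S x := (\sum_(0 <= k <oo) (w k * h x ^+ (2 * k.+1))%:E)%E.
have hX0 x k : 0 <= h x ^+ (2 * k) by rewrite exprM exprn_ge0// sqr_ge0.
have wh0 x k : (0 <= (w k * h x ^+ (2 * k.+1))%:E)%E by rewrite lee_fin mulr_ge0.
have mwh k : measurable_fun (@torus R d) (fun x => (w k * h x ^+ (2 * k.+1))%:E).
  apply/measurable_EFinP; apply: measurable_funM; first exact: measurable_cst.
  exact: measurable_funX.
have pointwise x : ((a x * `|h x|)%:E <=
    B%:E * (expR 1 + 2 `^ (d%:R / 2) * L x)%:E + S x)%E.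
  set k := Num.trunc (ln (1 + a x)).
  apply: le_trans (_ : (a x * (B * half_pow k.+1) + w k * `|h x| ^+ (2 * k.+1))%:E <= _)%E.
    rewrite lee_fin split_product ?mulr_gt0//.
    exact: le_exp_log_level.
  rewrite EFinD leeD//.
    by rewrite -EFinM lee_fin mulrCA ler_wpM2l ?(ltW B0)//; exact: half_pow_log_level.
  (* The single term that is needed is bounded by the whole series. *)
  apply: le_trans (nneseries_lim_ge k.+1 (fun n _ _ => wh0 x n)).
  rewrite big_nat_recr//= -normrX ger0_norm//.
  by rewrite leeDr// sume_ge0.
have S0 x : (0 <= S x)%E by apply: nneseries_ge0 => k _ _; exact: wh0.
have mS : measurable_fun (@torus R d) S.
  by apply: ge0_emeasurable_sum => // k x _ _; exact: wh0.
have intS : (\int[leb R d]_(x in @torus R d) S x <= B%:E)%E.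
  rewrite integral_nneseries//.
  apply: le_trans (epsilon_trick0 xpredT (ltW B0)).
  apply: lee_nneseries => [k _ _|k _]; first exact: integral_ge0.
  under eq_integral do rewrite EFinM.
  rewrite (ge0_integralZl _ mT); last exact: w0.
  - apply: le_trans (lee_wpmul2l _ (hQ k.+1 isT)) _; first exact: w0.
    rewrite -EFinM lee_fin /w -half_pow_sqr natrX.
    set v := half_pow k.+1.
    have -> : expR 1 ^+ k.+1 / (B * v) ^+ (2 * k.+1).-1 * (v ^+ 2 * Q) ^+ k.+1 =
        B * (v / (2 ^+ d) ^+ k.+1) / 2 ^+ k.+1.
      have Bv0 : 0 < B * v by rewrite mulr_gt0 ?half_pow0.
      have vQ0 : 0 < v ^+ 2 * Q by rewrite mulr_gt0 ?exprn_gt0 ?half_pow0.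
      have BvE : (B * v) ^+ (2 * k.+1).-1 * (B * v) =
          expR 1 ^+ k.+1 * (v ^+ 2 * Q) ^+ k.+1 * ((2 ^+ d) ^+ k.+1 * 2 ^+ k.+1).
        rewrite -exprSr prednK ?muln_gt0// (exprM (B * v)) (exprMn _ B v) B2 -!exprMn [2 ^+ d.+1]exprS.
        by congr (_ ^+ _); ring.
      have key (x y c t p z : R) : 0 < x -> 0 < y -> 0 < c -> 0 < t -> 0 < z ->
          p * z = x * y * (c * t) -> x / p * y = z / c / t.
        move=> x0 y0 c0 t0 z0 pE.
        have -> : p = x * y * (c * t) / z by rewrite -pE mulfK ?gt_eqF.
        by field; rewrite !gt_eqF.
      rewrite [B * (_ / _)]mulrA; apply: key BvE => //; rewrite exprn_gt0 ?expR_gt0//.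
    rewrite ler_wpM2r ?invr_ge0 ?exprn_ge0// ler_piMr ?(ltW B0)//.
    by rewrite ler_pdivrMr ?mul1r ?exprn_gt0 ?half_pow_le.
  - by apply/measurable_EFinP; exact: measurable_funX.
  - by move=> x _; rewrite lee_fin.
have mF : measurable_fun (@torus R d)
    (fun x => (expR 1 + 2 `^ (d%:R / 2) * L x)%:E).
  apply/measurable_EFinP; apply: measurable_funD; first exact: measurable_cst.
  by apply: measurable_funM; [exact: measurable_cst|exact: mL].
have C0 : 0 <= 2 `^ (d%:R / 2) :> R by exact: powR_ge0.
have e0 : 0 <= expR 1 :> R by exact: expR_ge0.
have F0 x : 0 <= expR 1 + 2 `^ (d%:R / 2) * L x :> R.
  by apply: addr_ge0 => //; exact: mulr_ge0.
have BF0 x : (0 <= B%:E * (expR 1 + 2 `^ (d%:R / 2) * L x)%:E)%E.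
  by rewrite mule_ge0 ?lee_fin// ltW.
have mBF : measurable_fun (@torus R d)
    (fun x => B%:E * (expR 1 + 2 `^ (d%:R / 2) * L x)%:E)%E.
  by apply: emeasurable_funM; [exact: measurable_cst|exact: mF].
apply: (@le_trans _ _ (\int[leb R d]_(x in @torus R d)
    (B%:E * (expR 1 + 2 `^ (d%:R / 2) * L x)%:E + S x))%E).
  apply: (ge0_le_integral _ mT).
  - by move=> x _; rewrite lee_fin mulr_ge0.
  - apply/measurable_EFinP; apply: measurable_funM; first exact: ma.
    exact: (measurableT_comp (@normr_measurable R setT) mh).
  - by apply: emeasurable_funD; [exact: mBF|exact: mS].
  - by move=> x _; exact: pointwise.
rewrite (ge0_integralD _ mT)//.
rewrite (ge0_integralZl _ mT mF); [|by move=> x _; rewrite lee_fin|exact: ltW].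
have I0 : (0 <= \int[leb R d]_(x in @torus R d) (L x)%:E)%E.
  by apply: integral_ge0 => x _; rewrite lee_fin.
have intF : (\int[leb R d]_(x in @torus R d)
    (expR 1 + 2 `^ (d%:R / 2) * L x)%:E =
    (expR 1)%:E + (2 `^ (d%:R / 2))%:E *
      \int[leb R d]_(x in @torus R d) (L x)%:E)%E.
  under eq_integral do rewrite EFinD EFinM.
  rewrite (ge0_integralD _ mT).
  - rewrite integral_cst// (ge0_integralZl _ mT).
    + by congr (_ + _)%E; rewrite [X in (_ * X)%E]leb_torus mule1.
    + by apply/measurable_EFinP; exact: mL.
    + by move=> x _; rewrite lee_fin.
    + exact: C0.
  - by move=> x _; exact: e0.
  - exact: measurable_cst.
  - by move=> x _; rewrite mule_ge0 ?lee_fin.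
  - apply: emeasurable_funM; first exact: measurable_cst.
    by apply/measurable_EFinP; exact: mL.
rewrite intF; set J := (\int[_]_(x in _) (L x)%:E)%E in I0 *.
apply: le_trans (leeD2l _ intS) _; rewrite /dual_const -/B.
case: J I0 => [j|_|//]; last first.
  rewrite addeC.
  by rewrite [leRHS]gt0_muley ?leey// lte_fin mulr_gt0// ltr_wpDl ?addr_ge0.
rewrite lee_fin => j0.
have -> : (B%:E * ((expR 1)%:E + (2 `^ (d%:R / 2))%:E * j%:E) + B%:E =
  (B * (expR 1 + 2 `^ (d%:R / 2) * j) + B)%:E)%E by [].
have -> : ((B * (expR 1 + 2 `^ (d%:R / 2) + 1))%:E * (1 + j%:E) =
  (B * (expR 1 + 2 `^ (d%:R / 2) + 1) * (1 + j))%:E)%E by [].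
rewrite lee_fin.
have := mulr_ge0 (ltW B0) e0; have := mulr_ge0 (ltW B0) C0.
by nra.
Qed.
End LlogL_duality.

(** * Square-summability of one family of coefficients *)

Section fourier_l2.
Context {R : realType} {d : nat}.

(** Taking [t = 0] and [t = - pi / 2] gives the cosine and sine coefficients. *)
Definition fourier_phase (g : leb_space R d -> R) (t : R) (k : d.-tuple int) : R :=
  \int[leb R d]_(x in @torus R d) (g x * cos (t + 2 * pi * dotz k x)).

Lemma dual_const_gt0 (Q : R) : 0 < Q -> 0 < dual_const d Q.
Proof.
move=> Q0; rewrite /dual_const mulr_gt0//.
by rewrite sqrtr_gt0 !mulr_gt0 ?expR_gt0 ?exprn_gt0.
Qed.

Definition moment_const (D : R) : R := 4 ^+ d * (D * 8192 ^+ d).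

Lemma pow8192_gt0 : 0 < 8192 ^+ d :> R.
Proof. by apply: exprn_gt0; rewrite ltr0n. Qed.

Lemma moment_const_gt0 D : 0 < D -> 0 < moment_const D.
Proof.
move=> D0; apply: mulr_gt0; first by apply: exprn_gt0; rewrite ltr0n.
exact: mulr_gt0 D0 pow8192_gt0.
Qed.

Variables (a : leb_space R d -> R).
Hypotheses (ma : measurable_fun (@torus R d) a) (a0 : forall x, 0 <= a x).

Let I := (\int[leb R d]_(x in @torus R d)
       (a x * ln (1 + a x) `^ (d%:R / 2))%:E)%E.
Hypothesis Ioo : (I < +oo)%E.

Let mT : measurable (@torus R d).
Proof. exact: measurable_torus. Qed.

Let I_fin : I \is a fin_num.
Proof.
rewrite ge0_fin_numE//; apply: integral_ge0 => x _.
by rewrite lee_fin mulr_ge0 ?powR_ge0.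
Qed.

Let I0 : 0 <= fine I.
Proof.
apply: fine_ge0; apply: integral_ge0 => x _.
by rewrite lee_fin mulr_ge0 ?powR_ge0.
Qed.

(** [LlogL_duality] for the constant function [1], whose moments are all [1]. *)
Lemma LlogL_integrable : (leb R d).-integrable (@torus R d) (EFin \o a).
Proof.
apply/integrableP; split; first exact/measurable_EFinP.
have m1 : measurable_fun (@torus R d) (fun=> 1 : R) by exact: measurable_cst.
apply: le_lt_trans (_ : \int[leb R d]_(x in @torus R d) (a x * `|1|)%:E < +oo)%E; last first.
  apply: le_lt_trans (LlogL_duality ltr01 a0 ma m1 _) _; last first.
    by rewrite -/I -(fineK I_fin) ltry.
  move=> n n0; rewrite integral_cst// [X in (_ * X)%E]leb_torus mule1 lee_fin.
  by rewrite expr1n mulr1 -exprM exprn_ege1// ler1n.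
apply: (ge0_le_integral _ mT).
- by move=> x _; exact: abse_ge0.
- by apply: measurableT_comp => //; exact/measurable_EFinP.
- apply/measurable_EFinP; apply: measurable_funM => //.
- by move=> x _; rewrite /= normr1 mulr1 ger0_norm.
Qed.

Variable g : leb_space R d -> R.
Hypotheses (mg : measurable_fun (@torus R d) g) (ga : forall x, `|g x| <= a x).

Lemma integrable_phase (t : R) (k : d.-tuple int) :
  (leb R d).-integrable (@torus R d)
    (fun x => (g x * cos (t + 2 * pi * dotz k x))%:E).
Proof.
apply: (le_integrable mT _ _ LlogL_integrable).
  apply/measurable_EFinP; apply: measurable_funM; first exact: mg.
  apply: measurable_funTS.
  apply: (measurableT_comp _ (f := cos)).
    by apply: continuous_measurable_fun; exact: continuous_cos.
  apply: measurable_funD; first exact: measurable_cst.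
  apply: measurable_funM; first exact: measurable_cst.
  exact: measurable_dotz.
move=> x _; rewrite /= lee_fin normrM (ger0_norm (a0 x)).
by apply: le_trans (ga x); rewrite ler_piMr// cos_max.
Qed.
Lemma fourier_phase_sum (K : finType) (fr : K -> d.-tuple int) (kap : K -> R) t :
  \sum_k kap k * fourier_phase g t (fr k) =
  \int[leb R d]_(x in @torus R d) (g x * trig_poly fr kap (fun=> t) x).
Proof.
have int1 k : (leb R d).-integrable (@torus R d)
    (fun x => (kap k * (g x * cos (t + 2 * pi * dotz (fr k) x)))%:E).
  under eq_fun do rewrite EFinM.
  by apply: integrableZl => //; exact: integrable_phase.
rewrite /Rintegral (eq_integral (fun x =>
    \sum_k (kap k * (g x * cos (t + 2 * pi * dotz (fr k) x)))%:E)%E); last first.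
  move=> x _; rewrite sumEFin; congr EFin; rewrite mulr_sumr.
  by apply: eq_bigr => k _; rewrite mulrCA.
rewrite integral_sum// -sum_fine; last first.
  by move=> k _; exact: integrable_fin_num.
apply: eq_bigr => k _; rewrite -/(Rintegral _ _ _) RintegralZl//.
exact: integrable_phase.
Qed.

Lemma fourier_phase_dual (K : finType) (fr : K -> d.-tuple int) (kap : K -> R)
    t (E : set (d.-tuple int)) (D : R) :
  0 < D -> (D_ R E <= D%:E)%E -> injective fr -> (forall k, E (fr k)) ->
  \sum_k kap k ^+ 2 <= 1 ->
  \sum_k kap k * fourier_phase g t (fr k) <=
    dual_const d (moment_const D) * (1 + fine I).
Proof.
move=> D0 ED fr_inj frE kap1; rewrite fourier_phase_sum.
set h := trig_poly fr kap (fun=> t).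
have mh : measurable_fun (@torus R d) h.
  by apply: measurable_funTS; exact: measurable_trig_poly.
have momh n : (0 < n)%N ->
    (\int[leb R d]_(x in @torus R d) (h x ^+ (2 * n))%:E <=
      ((n%:R ^+ d * moment_const D) ^+ n)%:E)%E.
  move=> n0; apply: le_trans (torus_moment _ _ n0 ED fr_inj frE) _.
  have S0 : 0 <= \sum_k kap k ^+ 2 by apply: sumr_ge0 => k _; exact: sqr_ge0.
  rewrite lee_fin /moment_const; move: (8192 ^+ d) pow8192_gt0 => c c0.
  have Dc : 0 <= D * c by rewrite mulr_ge0// ltW.
  have n4 : 0 <= (4 * n)%:R ^+ d :> R by rewrite exprn_ge0.
  rewrite lerXn2r ?nnegrE//.
  - by apply: mulr_ge0 => //; exact: mulr_ge0.
  - by rewrite mulr_ge0 ?exprn_ge0// mulr_ge0 ?exprn_ge0.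
  - rewrite [leRHS]mulrA -exprMn -natrM [(n * 4)%N]mulnC.
    by apply: ler_wpM2l => //; rewrite ler_piMr.
have := LlogL_duality (moment_const_gt0 D0) a0 ma mh momh.
rewrite -/I -(fineK I_fin) => dual.
rewrite -lee_fin; apply: le_trans dual.
have int_gh : (leb R d).-integrable (@torus R d) (EFin \o (fun x => g x * h x)).
  rewrite (_ : _ \o _ = (fun x =>
    \sum_k (kap k * (g x * cos (t + 2 * pi * dotz (fr k) x)))%:E)%E); last first.
    apply/funext => x /=; rewrite sumEFin; congr EFin; rewrite mulr_sumr.
    by apply: eq_bigr => k _; rewrite mulrCA.
  apply: integrable_sum => // k _; under eq_fun do rewrite EFinM.
  by apply: integrableZl => //; exact: integrable_phase.
apply: (@le_trans _ _ `|\int[leb R d]_(x in @torus R d) (g x * h x)|%:E).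
  by rewrite lee_fin ler_norm.
rewrite EFin_normr_Rintegral//.
apply: le_trans (le_abse_integral _ mT _) _; first by case/integrableP: int_gh.
apply: (ge0_le_integral _ mT).
- by move=> x _; exact: abse_ge0.
- by apply: measurableT_comp; [exact: abse_measurable|case/integrableP: int_gh].
- apply/measurable_EFinP; apply: measurable_funM; first exact: ma.
  exact: (measurableT_comp (@normr_measurable R setT) mh).
- by move=> x _; rewrite /= lee_fin normrM ler_wpM2r.
Qed.

(** The converse of Cauchy-Schwarz: test [fourier_phase_dual] on the coefficients
    themselves, divided by their Euclidean norm. *)
Lemma fourier_phase_l2 (K : finType) (fr : K -> d.-tuple int)
    t (E : set (d.-tuple int)) (D : R) :
  0 < D -> (D_ R E <= D%:E)%E -> injective fr -> (forall k, E (fr k)) ->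
  \sum_k fourier_phase g t (fr k) ^+ 2 <=
    (dual_const d (moment_const D) * (1 + fine I)) ^+ 2.
Proof.
move=> D0 ED fr_inj frE; set X := _ * _.
have X0 : 0 <= X.
  by rewrite mulr_ge0 ?addr_ge0// ltW// dual_const_gt0// moment_const_gt0.
set S := \sum_k _.
have S0 : 0 <= S by apply: sumr_ge0 => k _; exact: sqr_ge0.
have [S_eq0|S_neq0] := eqVneq S 0; first by rewrite S_eq0 sqr_ge0.
have s0 : 0 < Num.sqrt S by rewrite sqrtr_gt0 lt_neqAle eq_sym S_neq0.
have sS : Num.sqrt S ^+ 2 = S by rewrite sqr_sqrtr.
rewrite -sS lerXn2r ?nnegrE ?(ltW s0)//.
have := @fourier_phase_dual K fr
  (fun k => (Num.sqrt S)^-1 * fourier_phase g t (fr k)) t E D D0 ED fr_inj frE.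
rewrite (_ : \sum_k _ = (Num.sqrt S)^-1 ^+ 2 * S); last first.
  by rewrite mulr_sumr; apply: eq_bigr => k _; rewrite exprMn.
rewrite (_ : \sum_k _ = (Num.sqrt S)^-1 * S); last first.
  by rewrite mulr_sumr; apply: eq_bigr => k _; rewrite -mulrA -expr2.
rewrite exprVn sS mulVf// lexx => /(_ isT).
by rewrite -{2}sS expr2 mulKf// gt_eqF.
Qed.

End fourier_l2.

(** * The Fourier coefficients of a complex function *)

Section complex_coefficients.
Context {R : realType} {d : nat}.
Implicit Types f : leb_space R d -> R[i].

Lemma cnorm_sqr (z : R[i]) : cnorm z ^+ 2 = complex.Re z ^+ 2 + complex.Im z ^+ 2.
Proof.
by case: z => x y; rewrite /cnorm /= sqr_sqrtr// addr_ge0 ?sqr_ge0.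
Qed.

Lemma cnorm_ge0 (z : R[i]) : 0 <= cnorm z.
Proof. by case: z => x y; rewrite /cnorm /= sqrtr_ge0. Qed.

Lemma Re_le_cnorm (z : R[i]) : `|complex.Re z| <= cnorm z.
Proof.
rewrite -ler_sqr ?nnegrE ?cnorm_ge0// cnorm_sqr real_normK ?num_real//.
by rewrite lerDl sqr_ge0.
Qed.

Lemma Im_le_cnorm (z : R[i]) : `|complex.Im z| <= cnorm z.
Proof.
rewrite -ler_sqr ?nnegrE ?cnorm_ge0// cnorm_sqr real_normK ?num_real//.
by rewrite lerDr sqr_ge0.
Qed.

Lemma measurable_cnorm f :
  measurable_fun (@torus R d) (fun x => complex.Re (f x)) ->
  measurable_fun (@torus R d) (fun x => complex.Im (f x)) ->
  measurable_fun (@torus R d) (fun x => cnorm (f x)).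
Proof.
move=> mRe mIm.
rewrite (_ : (fun x => _) = (fun x => Num.sqrt (complex.Re (f x) ^+ 2 + complex.Im (f x) ^+ 2))); last first.
  by apply/funext => x; rewrite -cnorm_sqr sqrtr_sqr ger0_norm// cnorm_ge0.
have msqrt : measurable_fun setT (@Num.sqrt R).
  by apply: continuous_measurable_fun; exact: sqrt_continuous.
apply: (measurableT_comp msqrt
  (g := fun x => complex.Re (f x) ^+ 2 + complex.Im (f x) ^+ 2)).
by apply: measurable_funD; exact: measurable_funX.
Qed.

Lemma fourierE f k : LlogL f ->
  let Re_f x := complex.Re (f x) in let Im_f x := complex.Im (f x) in
  fourier f k = Complex
    (fourier_phase Re_f 0 k + fourier_phase Im_f (- (pi / 2)) k)
    (fourier_phase Im_f 0 k - fourier_phase Re_f (- (pi / 2)) k).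
Proof.
move=> [mRe mIm foo] Re_f Im_f.
have mf := measurable_cnorm mRe mIm.
have iRe t := @integrable_phase R d _ mf (fun x => cnorm_ge0 (f x)) foo Re_f mRe
  (fun x => Re_le_cnorm (f x)) t k.
have iIm t := @integrable_phase R d _ mf (fun x => cnorm_ge0 (f x)) foo Im_f mIm
  (fun x => Im_le_cnorm (f x)) t k.
have mT : measurable (@torus R d) by exact: measurable_torus.
rewrite /fourier /torus_int; congr Complex.
  rewrite /fourier_phase -RintegralD; [|exact: mT|exact: iRe|exact: iIm].
  apply: eq_Rintegral => x _.
  rewrite /Re_f /Im_f; case: (f x) => u v /=.
  rewrite cosN sinN add0r [- (pi / 2) + _]addrC cosBpihalf; ring.
rewrite /fourier_phase -RintegralB; [|exact: mT|exact: iIm|exact: iRe].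
apply: eq_Rintegral => x _.
rewrite /Re_f /Im_f; case: (f x) => u v /=.
rewrite cosN sinN add0r [- (pi / 2) + _]addrC cosBpihalf; ring.
Qed.

(** Each real and imaginary part is a sum of two of the four families of cosine
    and sine coefficients of the real and imaginary parts of [f], so the squared
    sum is at most [8], hence [3 ^ 2], times the bound for one family. *)
Lemma fourier_l2 f (K : finType) (fr : K -> d.-tuple int)
    (E : set (d.-tuple int)) (D : R) :
  LlogL f -> 0 < D -> (D_ R E <= D%:E)%E -> injective fr -> (forall k, E (fr k)) ->
  \sum_k cnorm (fourier f (fr k)) ^+ 2 <=
    (3 * dual_const d (@moment_const R d D) * (1 + fine (LlogL_int f))) ^+ 2.
Proof.
move=> fL D0 ED fr_inj frE; have [mRe mIm foo] := fL.
have mf := measurable_cnorm mRe mIm.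
have bRe t := @fourier_phase_l2 R d _ mf (fun x => cnorm_ge0 (f x)) foo _ mRe
  (fun x => Re_le_cnorm (f x)) K fr t E D D0 ED fr_inj frE.
have bIm t := @fourier_phase_l2 R d _ mf (fun x => cnorm_ge0 (f x)) foo _ mIm
  (fun x => Im_le_cnorm (f x)) K fr t E D D0 ED fr_inj frE.
rewrite -mulrA exprMn -[fine _]/(fine (LlogL_int f)).
have := bRe 0; have := bRe (- (pi / 2)); have := bIm 0; have := bIm (- (pi / 2)).
rewrite -/(LlogL_int f).
set X := (_ * _) ^+ 2; move=> b1 b2 b3 b4.
have X0 : 0 <= X by exact: sqr_ge0.
pose u1 k := fourier_phase (fun x => complex.Re (f x)) 0 (fr k).
pose u2 k := fourier_phase (fun x => complex.Re (f x)) (- (pi / 2)) (fr k).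
pose u3 k := fourier_phase (fun x => complex.Im (f x)) 0 (fr k).
pose u4 k := fourier_phase (fun x => complex.Im (f x)) (- (pi / 2)) (fr k).
apply: (@le_trans _ _ (\sum_k (2 * u1 k ^+ 2 + 2 * u2 k ^+ 2 + 2 * u3 k ^+ 2 + 2 * u4 k ^+ 2))).
  apply: ler_sum => k _; rewrite fourierE// cnorm_sqr /=.
  rewrite -/(u1 k) -/(u2 k) -/(u3 k) -/(u4 k).
  by have := sqr_ge0 (u1 k - u4 k); have := sqr_ge0 (u3 k + u2 k); nra.
rewrite !big_split/= -!mulr_sumr.
have -> : 3 ^+ 2 * X = 9 * X by ring.
by rewrite /u1 /u2 /u3 /u4; lra.
Qed.

End complex_coefficients.

Theorem proposition2 (R : realType) (d : nat) (d_gt0 : (0 < d)%N) :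
  exists A : \bar R -> R,
    forall E : set (d.-tuple int), E !=set0 -> (D_ R E < +oo)%E ->
      0 < A (D_ R E) /\
      forall f : leb_space R d -> R[i], LlogL f ->
        ((\esum_(k in E) ((cnorm (fourier f k)) ^+ 2)%:E) `^ 2^-1
           <= (A (D_ R E))%:E * (1 + LlogL_int f))%E.
Proof.
(* Adding [1] makes the constant positive whatever the value of [D_E]. *)
exists (fun D => 3 * dual_const d (@moment_const R d (`|fine D| + 1))) => E _ DEoo.
set D : R := `|fine (D_ R E)| + 1.
have D0 : 0 < D by rewrite ltr_wpDl.
have ED : (D_ R E <= D%:E)%E.
  rewrite /D; case: (D_ R E) DEoo => [r _|//|_]; last by rewrite leNye.
  by rewrite lee_fin (le_trans (ler_norm r))// lerDl.
have A0 : 0 < 3 * dual_const d (@moment_const R d D).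
  by rewrite mulr_gt0// dual_const_gt0// moment_const_gt0.
split=> // f fL; have [_ _ foo] := fL.
have I0 : (0 <= LlogL_int f)%E.
  by apply: integral_ge0 => x _; rewrite lee_fin mulr_ge0 ?powR_ge0 ?cnorm_ge0.
rewrite -(@fineK _ (LlogL_int f)) ?ge0_fin_numE//.
pose Y := 3 * dual_const d (@moment_const R d D) * (1 + fine (LlogL_int f)).
have Y0 : 0 <= Y by rewrite mulr_ge0 ?(ltW A0)// addr_ge0// fine_ge0.
rewrite [leRHS](_ : _ = Y%:E)//.
have le_Y2 : (\esum_(k in E) (cnorm (fourier f k) ^+ 2)%:E <= (Y ^+ 2)%:E)%E.
  apply: ge_ereal_sup => _ [F [finF FE] <-].
  rewrite fsbig_finite// sumEFin lee_fin big_seq_fsetE.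
  have frE (k : fset_set F) : E (val k).
    by apply: FE; have := valP k; rewrite in_fset_set// inE.
  exact: (fourier_l2 fL D0 ED val_inj frE).
have -> : Y%:E = ((Y ^+ 2)%:E `^ 2^-1)%E.
  by rewrite poweR_EFin powR12_sqrt ?sqr_ge0// sqrtr_sqr ger0_norm.
apply: gt0_ler_poweR => //.
- by rewrite in_itv/= leey andbT; apply: esum_ge0 => k _; rewrite lee_fin sqr_ge0.
- by rewrite in_itv/= leey andbT lee_fin sqr_ge0.
Qed.
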